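(* The following statement is false: for every complete quotient map $q:E\twoheadrightarrow F$ between Banach operator spaces, every finite-dimensional subspace $F_0\subseteq F$ and every $\varepsilon>0$, there exists a finite-dimensional subspace $E_0\subseteq E$ such that $q(E_0)=F_0$ and for every $n$ and every $y\in M_n(F_0)$ there exists $x\in M_n(E_0)$ with $q_n(x)=y$ and $\|x\|_{M_n(E_0)}\le(1+\varepsilon)\|y\|_{M_n(F_0)}$.
   Context: A Banach operator space is a complete operator space (norms on all matrix levels $M_n(E)$ satisfying Ruan's axioms). A linear map $q:E\to F$ is a complete quotient if it is onto and the induced map $E/\ker q\to F$ is a completely isometric isomorphism; $q_n$ denotes its $n$-th amplification acting entrywise on matrices. *)

(* Defs.v *)
(* scalars are the complex numbers R[i] over an arbitrary
   realType R (every realType is isomorphic to the real numbers). *)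
From HB Require Import structures.
From mathcomp Require Import all_boot all_order all_algebra.
From mathcomp Require Import reals complex.
Set Implicit Arguments. Unset Strict Implicit. Unset Printing Implicit Defensive.
Import Order.TTheory GRing.Theory Num.Theory.
Local Open Scope ring_scope.

Section OpSpaces.
Variable R : realType.
Local Notation C := (R[i]).

Definition l2sq (m : nat) (v : 'cV[C]_m) : R :=
  \sum_(i < m) (ComplexField.Normc.normc (v i 0)) ^+ 2.

Definition opnorm_le (n m : nat) (a : 'M[C]_(n, m)) (c : R) : Prop :=
  0 <= c /\ forall v : 'cV[C]_m, l2sq (a *m v) <= c ^+ 2 * l2sq v.

Variable V : lmodType C.

Definition lsmul (n m p : nat) (a : 'M[C]_(n, m)) (x : 'M[V]_(m, p)) : 'M[V]_(n, p) :=
  \matrix_(i, j) \sum_(k < m) a i k *: x k j.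
Definition rsmul (n m p : nat) (x : 'M[V]_(n, m)) (b : 'M[C]_(m, p)) : 'M[V]_(n, p) :=
  \matrix_(i, j) \sum_(k < m) b k j *: x i k.

(* A family of norms on M_n(V) (n : nat) satisfying Ruan's axioms. *)
Definition is_operator_space (nrm : forall n, 'M[V]_n -> R) : Prop :=
  [/\
      forall n (x : 'M[V]_n), 0 <= nrm n x,
      forall n (x : 'M[V]_n), nrm n x = 0 -> x = 0,
      forall n (x y : 'M[V]_n), nrm n (x + y) <= nrm n x + nrm n y
    & forall n (a : C) (x : 'M[V]_n),
        nrm n (map_mx (fun v => a *: v) x) = ComplexField.Normc.normc a * nrm n x ] /\
  (
      forall m n (x : 'M[V]_m) (y : 'M[V]_n),
        nrm (m + n)%N (block_mx x 0 0 y) = Num.max (nrm m x) (nrm n y)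
    /\
      forall m n (a : 'M[C]_(n, m)) (x : 'M[V]_m) (b : 'M[C]_(m, n)) (ca cb : R),
        opnorm_le a ca -> opnorm_le b cb ->
        nrm n (rsmul (lsmul a x) b) <= ca * nrm m x * cb ).

(* the 1x1 matrix with entry v, so that nrm 1 (mx1 v) is the norm on V = M_1(V) *)
Definition mx1 (v : V) : 'M[V]_1 := const_mx v.

Definition complete_os (nrm : forall n, 'M[V]_n -> R) : Prop :=
  forall u : nat -> V,
    (forall e : R, 0 < e -> exists N : nat, forall k l : nat, (N <= k)%N -> (N <= l)%N ->
       nrm 1%N (mx1 (u k - u l)) <= e) ->
    exists lim : V, forall e : R, 0 < e -> exists N : nat, forall k : nat, (N <= k)%N ->
       nrm 1%N (mx1 (u k - lim)) <= e.

Definition banach_operator_space (nrm : forall n, 'M[V]_n -> R) : Prop :=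
  is_operator_space nrm /\ complete_os nrm.

(* the linear span of a finite list of vectors (a finite-dimensional subspace) *)
Definition fspan (s : seq V) : V -> Prop :=
  fun v => exists c : 'I_(size s) -> C, v = \sum_(i < size s) c i *: s`_i.

End OpSpaces.

(* q : E -> F is a complete quotient: onto, and for every n and y in M_n(F),
   ||y|| = inf { ||x|| : q_n(x) = y }, i.e. E/ker q -> F is a complete isometry
   for the quotient operator space structure M_n(E/ker q) = M_n(E)/M_n(ker q). *)
Definition complete_quotient (R : realType) (E F : lmodType R[i])
    (nE : forall n, 'M[E]_n -> R) (nF : forall n, 'M[F]_n -> R)
    (q : {linear E -> F}) : Prop :=
  (forall y : F, exists x : E, q x = y) /\
  forall n (y : 'M[F]_n),
    (forall x : 'M[E]_n, map_mx q x = y -> nF n y <= nE n x) /\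
    (forall e : R, 0 < e -> exists x : 'M[E]_n, map_mx q x = y /\ nE n x < nF n y + e).

(* Main.v *)
(** Take [F] to be the [k]-dimensional l_infinity space.  For a finite list [s] of
    matrix tuples let [F_s] be [F] normed by the maps [a : F -> M_d] that are
    contractive on coordinates and on the contractive tuples listed in [s], a norm
    larger than that of [F].  [E] consists of the bounded families [x_s] in [F] that
    converge along the lists [s], normed by the supremum of the [F_s]-norms, and [q]
    is the limit.  A tuple [y] lifts to the family equal to [y] as soon as [y] occurs
    in [s], so [q] is a complete quotient.  On a finite dimensional [E_0] the
    convergence is uniform at all matrix levels, so a lifting of [F] into [E_0] would
    bound some [F_s]-norm by a constant times the norm of [F].

    That is impossible since l_1^k is not exact.  Let [u_i] be permutation matrices of
    involutions whose Schreier graph has large girth.  Against [u] itself, the [u_i]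
    have norm [k].  For a fixed contractive [y], however, the operator
    [A X = sum_i y_i X u_i] has norm at most [2 sqrt k] on vectors supported in a ball
    of the [k]-regular tree, so the normalised trace of a high power of [A^* A] is
    small, and compressing by the resolvent of the partial trace of that power makes
    [A] small while losing at most half of the trace. *)
Require Import Defs.
From HB Require Import structures.
From mathcomp Require Import all_boot all_order all_algebra all_fingroup.
From mathcomp Require Import reals complex boolp classical_sets functions.
From mathcomp Require Import ring lra zify.
Set Implicit Arguments. Unset Strict Implicit. Unset Printing Implicit Defensive.
Import Order.TTheory GRing.Theory Num.Theory.
Local Open Scope ring_scope.
Local Notation normc := ComplexField.Normc.normc.

(** * Hilbert-Schmidt inner product and norm on complex matrices *)

Section HilbertSchmidt.
Variable R : realType.
Local Notation C := (R[i]).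

Lemma ReD (x y : C) : complex.Re (x + y) = complex.Re x + complex.Re y.
Proof. by case: x y => a b []. Qed.

Lemma Re_sum (I : finType) (f : I -> C) :
  complex.Re (\sum_i f i) = \sum_i complex.Re (f i).
Proof. exact: (big_morph _ ReD erefl). Qed.

Lemma normc_sqr (x : C) : normc x ^+ 2 = complex.Re x ^+ 2 + complex.Im x ^+ 2.
Proof. by case: x => a b /=; rewrite sqr_sqrtr ?addr_ge0 ?sqr_ge0. Qed.

Lemma normc_ge0 (x : C) : 0 <= normc x.
Proof. by case: x => a b; exact: sqrtr_ge0. Qed.

Lemma normcD (x y : C) : normc (x + y) <= normc x + normc y.
Proof.
have := ComplexField.lec_normD x y.
by case: x y => [a b] [c d] /= /andP[].
Qed.

Lemma normcN (x : C) : normc (- x) = normc x.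
Proof. by case: x => a b /=; rewrite !sqrrN. Qed.

Lemma normc_real (x : R) : normc (x%:C)%C = `|x|.
Proof. by rewrite /= expr0n /= addr0 sqrtr_sqr. Qed.

Lemma normc_sum (I : finType) (f : I -> C) :
  normc (\sum_i f i) <= \sum_i normc (f i).
Proof.
elim/big_rec2: _ => [|i x y _ h]; first by rewrite ComplexField.Normc.normc0.
exact: le_trans (normcD _ _) (lerD (lexx _) h).
Qed.

Definition adj n m (X : 'M[C]_(n, m)) : 'M[C]_(m, n) := (map_mx conjc X)^T.

Lemma adjM n m p (X : 'M[C]_(n, m)) (Y : 'M[C]_(m, p)) :
  adj (X *m Y) = adj Y *m adj X.
Proof. by rewrite /adj map_mxM trmx_mul. Qed.

Lemma adjK n m (X : 'M[C]_(n, m)) : adj (adj X) = X.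
Proof. by apply/matrixP => i j; rewrite !mxE conjcK. Qed.

Lemma adj_one n : adj (1%:M : 'M[C]_n) = 1%:M.
Proof. by apply/matrixP => i j; rewrite !mxE rmorph_nat eq_sym. Qed.

(** Only the real part of the trace form is kept: it is symmetric and induces the same norm, so
    every estimate stays in [R]. *)
Definition ip n m (X Y : 'M[C]_(n, m)) : R := complex.Re (\tr (X *m adj Y)).

Lemma ipE n m (X Y : 'M[C]_(n, m)) :
  ip X Y = \sum_i \sum_j (complex.Re (X i j) * complex.Re (Y i j)
                        + complex.Im (X i j) * complex.Im (Y i j)).
Proof.
rewrite /ip /mxtrace Re_sum; apply: eq_bigr => i _.
rewrite mxE Re_sum; apply: eq_bigr => j _; rewrite !mxE.
by case: (X i j) (Y i j) => [a b] [c d] /=; rewrite mulrN opprK.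
Qed.

Lemma ipC n m (X Y : 'M[C]_(n, m)) : ip X Y = ip Y X.
Proof.
rewrite !ipE; apply: eq_bigr => i _; apply: eq_bigr => j _.
by rewrite ![complex.Re (X _ _) * _]mulrC ![complex.Im (X _ _) * _]mulrC.
Qed.

Lemma ipDl n m (X Y Z : 'M[C]_(n, m)) : ip (X + Y) Z = ip X Z + ip Y Z.
Proof. by rewrite /ip mulmxDl mxtraceD ReD. Qed.

Lemma ipDr n m (X Y Z : 'M[C]_(n, m)) : ip Z (X + Y) = ip Z X + ip Z Y.
Proof. by rewrite ipC ipDl !(ipC Z). Qed.

Lemma ip0l n m (Z : 'M[C]_(n, m)) : ip 0 Z = 0.
Proof. by rewrite /ip mul0mx mxtrace0. Qed.

Lemma ip_suml n m (I : Type) (r : seq I) (f : I -> 'M[C]_(n, m)) Z :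
  ip (\sum_(i <- r) f i) Z = \sum_(i <- r) ip (f i) Z.
Proof.
by apply: (big_morph (fun X => ip X Z)) => [X Y|]; rewrite ?ipDl ?ip0l.
Qed.

Lemma ip_sumr n m (I : Type) (r : seq I) (f : I -> 'M[C]_(n, m)) Z :
  ip Z (\sum_(i <- r) f i) = \sum_(i <- r) ip Z (f i).
Proof. by rewrite ipC ip_suml; apply: eq_bigr => i _; rewrite ipC. Qed.

Lemma ipZl n m (a : R) (X Y : 'M[C]_(n, m)) : ip ((a%:C)%C *: X) Y = a * ip X Y.
Proof.
rewrite /ip -scalemxAl mxtraceZ; case: (\tr _) => b c /=.
by rewrite mul0r subr0.
Qed.

Lemma ipZr n m (a : R) (X Y : 'M[C]_(n, m)) : ip X ((a%:C)%C *: Y) = a * ip X Y.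
Proof. by rewrite ipC ipZl ipC. Qed.

Lemma ip_mull n m p (y : 'M[C]_(p, n)) (X : 'M[C]_(n, m)) (Y : 'M[C]_(p, m)) :
  ip (y *m X) Y = ip X (adj y *m Y).
Proof. by rewrite /ip adjM adjK mulmxA -mulmxA mxtrace_mulC. Qed.

Lemma ip_mulr n m p (u : 'M[C]_(m, p)) (X : 'M[C]_(n, m)) (Y : 'M[C]_(n, p)) :
  ip (X *m u) Y = ip X (Y *m adj u).
Proof. by rewrite /ip adjM adjK mulmxA. Qed.

Definition hs n m (X : 'M[C]_(n, m)) : R := ip X X.

Lemma hsE n m (X : 'M[C]_(n, m)) : hs X = \sum_i \sum_j normc (X i j) ^+ 2.
Proof.
rewrite /hs ipE; apply: eq_bigr => i _; apply: eq_bigr => j _.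
by rewrite normc_sqr !expr2.
Qed.

Lemma hs_ge0 n m (X : 'M[C]_(n, m)) : 0 <= hs X.
Proof. by rewrite hsE; apply: sumr_ge0 => i _; apply: sumr_ge0 => j _; rewrite sqr_ge0. Qed.

Lemma hs0 n m : hs (0 : 'M[C]_(n, m)) = 0.
Proof. exact: ip0l. Qed.

Lemma hs_eq0 n m (X : 'M[C]_(n, m)) : hs X = 0 -> X = 0.
Proof.
rewrite hsE => h0; apply/matrixP => i j; rewrite mxE.
have s0 k : 0 <= \sum_j normc (X k j) ^+ 2 by apply: sumr_ge0 => l _; rewrite sqr_ge0.
have /(_ i isT) := psumr_eq0P (fun k _ => s0 k) h0.
move/(psumr_eq0P (fun l _ => sqr_ge0 (normc (X i l))))/(_ j isT)/eqP.
by rewrite sqrf_eq0 => /eqP; exact: ComplexField.Normc.eq0_normc.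
Qed.

Lemma hsZ n m (a : C) (X : 'M[C]_(n, m)) : hs (a *: X) = normc a ^+ 2 * hs X.
Proof.
rewrite !hsE mulr_sumr; apply: eq_bigr => i _; rewrite mulr_sumr.
by apply: eq_bigr => j _; rewrite mxE ComplexField.Normc.normcM exprMn.
Qed.

Lemma hsD n m (X Y : 'M[C]_(n, m)) : hs (X + Y) = hs X + ip X Y *+ 2 + hs Y.
Proof. by rewrite /hs ipDl !ipDr (ipC Y X) mulr2n !addrA. Qed.

Lemma cauchy_schwarz n m (X Y : 'M[C]_(n, m)) : ip X Y ^+ 2 <= hs X * hs Y.
Proof.
have [Y0|Y0] := eqVneq (hs Y) 0.
  by rewrite (hs_eq0 Y0) ipC ip0l hs0 mulr0 expr0n.
have Yp : 0 < hs Y by rewrite lt_def Y0 hs_ge0.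
have := hs_ge0 (X + ((- (ip X Y / hs Y))%:C)%C *: Y).
rewrite hsD hsZ normc_real real_normK ?num_real // ipZr.
rewrite -(ler_pM2r Yp) mul0r.
set a := ip X Y; set b := hs Y in Yp Y0 *; move=> h.
have E : (hs X + (- (a / b) * a) *+ 2 + (- (a / b)) ^+ 2 * b) * b = hs X * b - a ^+ 2 by field.
by rewrite E subr_ge0 in h.
Qed.

Definition hn n m (X : 'M[C]_(n, m)) : R := Num.sqrt (hs X).

Lemma hn_ge0 n m (X : 'M[C]_(n, m)) : 0 <= hn X.
Proof. exact: sqrtr_ge0. Qed.

Lemma hn_sqr n m (X : 'M[C]_(n, m)) : hn X ^+ 2 = hs X.
Proof. by rewrite sqr_sqrtr ?hs_ge0. Qed.

Lemma hn0 n m : hn (0 : 'M[C]_(n, m)) = 0.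
Proof. by rewrite /hn hs0 sqrtr0. Qed.

Lemma hn_eq0 n m (X : 'M[C]_(n, m)) : hn X = 0 -> X = 0.
Proof. by move=> h; apply: hs_eq0; rewrite -hn_sqr h expr0n. Qed.

Lemma hn_le n m p q (X : 'M[C]_(n, m)) (Y : 'M[C]_(p, q)) c :
  0 <= c -> hs X <= c ^+ 2 * hs Y -> hn X <= c * hn Y.
Proof.
move=> c0 h; rewrite -(@ler_pXn2r _ 2) ?nnegrE ?mulr_ge0 ?hn_ge0 //.
by rewrite exprMn !hn_sqr.
Qed.

Lemma ip_le n m (X Y : 'M[C]_(n, m)) : ip X Y <= hn X * hn Y.
Proof.
apply: le_trans (ler_norm _) _.
rewrite -(@ler_pXn2r _ 2) ?nnegrE ?mulr_ge0 ?hn_ge0 //.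
by rewrite real_normK ?num_real // exprMn !hn_sqr cauchy_schwarz.
Qed.

Lemma hnD n m (X Y : 'M[C]_(n, m)) : hn (X + Y) <= hn X + hn Y.
Proof.
rewrite -(@ler_pXn2r _ 2) ?nnegrE ?addr_ge0 ?hn_ge0 //.
by rewrite sqrrD !hn_sqr hsD lerD2r lerD2l lerMn2r ip_le orbT.
Qed.

Lemma hnZ n m (a : C) (X : 'M[C]_(n, m)) : hn (a *: X) = normc a * hn X.
Proof. by rewrite /hn hsZ sqrtrM ?sqr_ge0 // sqrtr_sqr ger0_norm ?normc_ge0. Qed.

Lemma hn_sum n m (I : Type) (r : seq I) (P : pred I) (f : I -> 'M[C]_(n, m)) :
  hn (\sum_(i <- r | P i) f i) <= \sum_(i <- r | P i) hn (f i).
Proof.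
elim/big_rec2: _ => [|i x y _ h]; first by rewrite hn0.
exact: le_trans (hnD _ _) (lerD (lexx _) h).
Qed.

Lemma hs_rows n m (X : 'M[C]_(n, m)) : hs X = \sum_i hs (row i X).
Proof.
rewrite hsE; apply: eq_bigr => i _; rewrite hsE big_ord1.
by apply: eq_bigr => j _; rewrite mxE.
Qed.

Lemma hs_cols n m (X : 'M[C]_(n, m)) : hs X = \sum_j hs (col j X).
Proof.
rewrite hsE exchange_big; apply: eq_bigr => j _; rewrite hsE.
by apply: eq_bigr => i _; rewrite big_ord1 mxE.
Qed.

Lemma hs_col_mx n1 n2 m (X : 'M[C]_(n1, m)) (Y : 'M[C]_(n2, m)) :
  hs (col_mx X Y) = hs X + hs Y.
Proof.
rewrite !hs_rows big_split_ord /=; congr (_ + _); apply: eq_bigr => i _.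
  by rewrite rowKu.
by rewrite rowKd.
Qed.

Lemma hn_row_le n m (X : 'M[C]_(n, m)) i : hn (row i X) <= hn X.
Proof.
rewrite -[hn X]mul1r; apply: hn_le => //; rewrite expr1n mul1r.
by rewrite [leRHS]hs_rows (bigD1 i) //= lerDl sumr_ge0 // => j _; rewrite hs_ge0.
Qed.

Lemma l2sqE m (v : 'cV[C]_m) : l2sq v = hs v.
Proof. by rewrite hsE; apply: eq_bigr => i _; rewrite big_ord1. Qed.

(** Left multiplication acts on each column separately, and squared norms add over columns. *)
Lemma opnorm_le_hn n m p (a : 'M[C]_(n, m)) c (X : 'M[C]_(m, p)) :
  opnorm_le a c -> hn (a *m X) <= c * hn X.
Proof.
move=> [c0 h]; apply: hn_le => //; rewrite !hs_cols mulr_sumr.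
apply: ler_sum => j _; rewrite -!l2sqE; have := h (col j X).
by rewrite !colE mulmxA.
Qed.

End HilbertSchmidt.

(** * Norm of a twisted adjacency operator on a tree *)

Section TreeEstimate.
Variable R : realType.
Local Notation C := (R[i]).

(** Twice the difference of the two sides is the sum of [hs (g i - g j)] over all pairs. *)
Lemma hs_sum_le n m (I : finType) (g : I -> 'M[C]_(n, m)) :
  hs (\sum_i g i) <= #|I|%:R * \sum_i hs (g i).
Proof.
have h : 0 <= \sum_i \sum_j hs (g i - g j).
  by apply: sumr_ge0 => i _; apply: sumr_ge0 => j _; rewrite hs_ge0.
have E : \sum_i \sum_j hs (g i - g j)
    = (#|I|%:R * \sum_i hs (g i)) *+ 2 - hs (\sum_i g i) *+ 2.
  have Eij i j : hs (g i - g j) = hs (g i) + hs (g j) - ip (g i) (g j) *+ 2.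
    rewrite hsD -[- g j]scaleN1r hsZ -[-1]opprK.
    have -> : - - (-1) = ((-1 : R)%:C)%C by rewrite opprK rmorphN rmorph1.
    by rewrite ipZr normc_real normrN1 expr1n !mul1r mulN1r mulNrn addrAC.
  under eq_bigr do under eq_bigr do rewrite Eij.
  under eq_bigr do rewrite sumrB big_split /= sumr_const sumrMnl -ip_sumr.
  rewrite sumrB big_split /= sumr_const !sumrMnl -ip_suml -/(hs _).
  by rewrite mulr_natl [in RHS]mulr2n.
rewrite E -mulrnBl pmulrn_lge0 // in h.
by rewrite -subr_ge0.
Qed.

Lemma hs_sum_cond n m k (Q : pred 'I_k) (g : 'I_k -> 'M[C]_(n, m)) :
  hs (\sum_(i | Q i) g i) <= k%:R * \sum_(i | Q i) hs (g i).
Proof.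
rewrite big_mkcond /=; apply: le_trans (hs_sum_le _) _.
rewrite card_ord ler_wpM2l ?ler0n // [leRHS]big_mkcond /=.
by apply: ler_sum => i _; case: ifP => // _; rewrite hs0.
Qed.

Lemma hsD_le n m (X Y : 'M[C]_(n, m)) : hs (X + Y) <= (hs X + hs Y) *+ 2.
Proof.
have := hs_sum_le (fun i : bool => if i then X else Y).
by rewrite !big_bool card_bool /= mulr_natl.
Qed.

Variables (k m : nat) (p : 'I_k -> 'I_m -> 'I_m).
Hypothesis pK : forall i, involutive (p i).

Definition umx i : 'M[C]_m := \matrix_(a, b) (b == p i a)%:R.

Lemma mul_umx n (X : 'M[C]_(n, m)) i a b : (X *m umx i) a b = X a (p i b).
Proof.
rewrite mxE (bigD1 (p i b)) //= mxE pK eqxx mulr1 big1 ?addr0 // => c.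
rewrite mxE => cb; suff -> : (b == p i c) = false by rewrite mulr0.
by apply: contraNF cb => /eqP ->; rewrite pK.
Qed.

Lemma col_mul_umx n (X : 'M[C]_(n, m)) i b : col b (X *m umx i) = col (p i b) X.
Proof. by apply/matrixP => a c; rewrite !mxE -mul_umx mxE. Qed.

Lemma hs_mul_umx n (X : 'M[C]_(n, m)) i : hs (X *m umx i) = hs X.
Proof.
rewrite !hs_cols [RHS](reindex_inj (inv_inj (pK i))).
by apply: eq_bigr => b _; rewrite col_mul_umx.
Qed.

Lemma adj_umx i : adj (umx i) = umx i.
Proof.
apply/matrixP => a b; rewrite !mxE rmorph_nat.
by congr (_%:R); congr nat_of_bool; apply/eqP/eqP => ->; rewrite pK.
Qed.

Lemma umxK i : umx i *m umx i = 1%:M.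
Proof. by apply/matrixP => a b; rewrite mul_umx !mxE (inj_eq (inv_inj (pK i))) eq_sym. Qed.

Lemma hs_umx_mul n (X : 'M[C]_(m, n)) i : hs (umx i *m X) = hs X.
Proof. by rewrite /hs ip_mull mulmxA adj_umx umxK mul1mx. Qed.

Definition contractive N (y : 'I_k -> 'M[C]_N) :=
  forall i (v : 'cV[C]_N), hs (y i *m v) <= hs v.

(** The sum of the tensor products of [y i] and [umx i], acting on tensors of C^N and C^m written as
    [N] by [m] matrices; column [b] is the component at the vertex [b] of the graph. *)
Definition twist N (y : 'I_k -> 'M[C]_N) (X : 'M[C]_(N, m)) : 'M[C]_(N, m) :=
  \sum_i y i *m X *m umx i.

Lemma col_twist N (y : 'I_k -> 'M[C]_N) X b :
  col b (twist y X) = \sum_i y i *m col (p i b) X.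
Proof.
rewrite /twist colE mulmx_suml; apply: eq_bigr => i _.
by rewrite -colE col_mul_umx !colE mulmxA.
Qed.

(* At every vertex of the support one edge leads to the parent and the other
   ones to children; [hd b] is the colour of the edge to the parent of [b]. *)
Lemma twist_tree_le N (y : 'I_k -> 'M[C]_N) X (hd : 'I_m -> option 'I_k)
    (B : pred 'I_m) :
  contractive y -> (forall b, ~~ B b -> col b X = 0) ->
  (forall b i, B b -> (hd (p i b) == Some i) = (hd b != Some i)) ->
  hs (twist y X) <= (4 * k)%:R * hs X.
Proof.
move=> yc X0 hdP.
(* The edge to the parent carries a single term and gets weight 1; the other terms, at most [k] in
   number, cost a factor [k] by Cauchy-Schwarz. Separating the two groups costs the factor 2
   below. *)
pose w b i : R := if hd b == Some i then 1 else k%:R.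
have w0 b i : 0 <= w b i by rewrite /w; case: ifP.
have colb b : hs (col b (twist y X)) <= 2%:R * \sum_i w b i * hs (col (p i b) X).
  rewrite col_twist (bigID (fun i => hd b == Some i)) /=.
  apply: le_trans (hsD_le _ _) _; rewrite mulr_natl lerMn2r /=.
  rewrite [leRHS](bigID (fun i => hd b == Some i)) /=; apply: lerD.
    case E : (hd b) => [j|]; last first.
      by rewrite big1 ?hs0 ?big1 //; move=> i; rewrite E.
    have H i : (Some j == Some i) = (i == j) by rewrite (inj_eq Some_inj) eq_sym.
    rewrite !(eq_bigl _ _ H) !big_pred1_eq /w E eqxx mul1r; exact: yc.
  apply: le_trans (hs_sum_cond _ _) _; rewrite mulr_sumr.
  apply: ler_sum => i /negbTE ni; rewrite /w ni ler_wpM2l ?ler0n //; exact: yc.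
rewrite hs_cols; apply: le_trans (ler_sum _ (fun b _ => colb b)) _.
rewrite -mulr_sumr exchange_big /=.
under eq_bigr => i _.
  rewrite (reindex_inj (inv_inj (pK i))) /=; under eq_bigr do rewrite pK.
  over.
rewrite exchange_big /= [hs X]hs_cols mulr_sumr mulr_sumr; apply: ler_sum => b _.
have [Bb|/X0 ->] := boolP (B b); last by rewrite hs0 big1 ?mulr0 // => i _; rewrite mulr0.
rewrite -mulr_suml mulrA ler_wpM2r ?hs_ge0 //.
have -> : (4 * k)%:R = 2%:R * (k%:R + k%:R) :> R by rewrite -natrD -natrM; congr _%:R; lia.
(* After reindexing, [b] counts with weight 1 along each edge to a child and with weight [k] along
   the edge to its parent, at most [k + k] in total. *)
rewrite ler_wpM2l ?ler0n // (bigID (fun i => hd b == Some i)) /= addrC; apply: lerD.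
  apply: le_trans (_ : \sum_(i < k) 1 <= _); last by rewrite sumr_const card_ord.
  rewrite big_mkcond /=; apply: ler_sum => i _; case: ifP => // ni.
  by rewrite /w hdP // ni.
case E : (hd b) => [j|]; last by rewrite big1 ?ler0n //; move=> i; rewrite E.
have H i : (Some j == Some i) = (i == j) by rewrite (inj_eq Some_inj) eq_sym.
by rewrite !(eq_bigl _ _ H) !big_pred1_eq /w hdP // E eqxx.
Qed.

End TreeEstimate.

(** * Finite permutation models of the [k]-regular tree *)

Section LargeGirth.
Variables (k L : nat).
Local Open Scope nat_scope.

Definition reduced (w : seq 'I_k) := sorted (fun a b => a != b) w.
Arguments reduced : simpl never.

(** A generator of the free product of [k] copies of Z/2 acting on reduced words, truncated at
    length [L]. Words that are not reduced are fixed, as are words of length [L] that would have to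
    grow; this keeps the step an involution of the finite set of all words of length at most [L]. *)
Definition word_step (i : 'I_k) (w : seq 'I_k) : seq 'I_k :=
  if ~~ reduced w then w else
  if ohead w == Some i then behead w else if size w < L then i :: w else w.

Lemma size_word_step i w : size w <= L -> size (word_step i w) <= L.
Proof.
rewrite /word_step; case: ifP => // _; case: ifP => _; last by case: ifP.
by rewrite size_behead => h; apply: leq_trans (leq_pred _) h.
Qed.

Lemma reduced_cons i w : reduced w -> ohead w != Some i -> reduced (i :: w).
Proof.
case: w => //= a w rw h; rewrite /reduced /= in rw *; rewrite rw andbT.
by apply: contra h => /eqP ->.
Qed.

Lemma reduced_behead w : reduced w -> reduced (behead w).
Proof. by case: w => //= a w /path_sorted. Qed.

Lemma ohead_behead i w : reduced w -> ohead w = Some i -> ohead (behead w) != Some i.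
Proof.
case: w => [|a [|b w]] //= /andP[ab _] [<-].
by rewrite (inj_eq Some_inj) eq_sym.
Qed.

Lemma word_stepK i w : size w <= L -> word_step i (word_step i w) = w.
Proof.
move=> sw; rewrite /word_step; have [rw|/negbTE nr] := boolP (reduced w); last by rewrite nr.
case: eqP => /= [hw|/eqP hw].
  rewrite reduced_behead //= (negbTE (ohead_behead rw hw)).
  case: w hw sw {rw} => [|a w] //= [->] sw; by rewrite sw.
case: ltnP => h /=; first by rewrite reduced_cons //= eqxx.
by rewrite rw /= (negbTE hw) ltnNge h.
Qed.

Lemma reduced_step i w : reduced w -> reduced (word_step i w).
Proof.
move=> rw; rewrite /word_step rw /=; case: ifP => [_|/negbT h]; first exact: reduced_behead.
by case: ifP => // _; exact: reduced_cons.
Qed.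

Lemma size_step_le i w : size (word_step i w) <= (size w).+1.
Proof.
rewrite /word_step; case: ifP => _ //; case: ifP => _; last by case: ifP.
by rewrite size_behead; lia.
Qed.

(** The first letter names the edge to the parent. Below length [L] no word is fixed for lack of
    room, whence the tree condition of [twist_tree_le]. *)
Lemma ohead_step i w : reduced w -> size w < L ->
  (ohead (word_step i w) == Some i) = (ohead w != Some i).
Proof.
move=> rw sw; rewrite /word_step rw /=; case: (ohead w =P Some i) => [hw|hw] /=.
  exact: negbTE (ohead_behead rw hw).
by rewrite sw /= eqxx.
Qed.

Definition bword_step i (w : L.-bseq 'I_k) : L.-bseq 'I_k :=
  Bseq (size_word_step i (size_bseq w)).

Lemma bword_stepK i : involutive (bword_step i).
Proof. by move=> w; apply: val_inj => /=; rewrite word_stepK ?size_bseq. Qed.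

Definition word_perm i : {perm L.-bseq 'I_k} := perm (inv_inj (bword_stepK i)).

Lemma word_permK i : (word_perm i * word_perm i = 1)%g.
Proof. by apply/permP => w; rewrite permM !permE bword_stepK. Qed.

(* The symmetric group of the set of words acts on itself by left translations;
   looking at where a permutation sends the empty word maps this action to the
   tree, so that every vertex has a ball of radius [L] covering a tree. *)
Lemma large_girth : exists m (p : 'I_k -> 'I_m -> 'I_m),
  [/\ 0 < m, forall i, involutive (p i) &
  forall b0, exists (hd : 'I_m -> option 'I_k) (B : nat -> pred 'I_m),
  [/\ B 0 b0, forall j b i, j < L -> B j b -> B j.+1 (p i b) &
      forall j b i, j < L -> B j b ->
        (hd (p i b) == Some i) = (hd b != Some i)]].
Proof.
exists #|{perm L.-bseq 'I_k}|.
exists (fun i b => enum_rank (enum_val b * word_perm i)%g).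
split=> [|i b|b0].
- by apply/card_gt0P; exists 1%g.
- by rewrite enum_rankK -mulgA word_permK mulg1 enum_valK.
(* [pt b] is the image of the empty word under the inverse of [b0] followed by [b]: thus [b0] lies
   over the root, and multiplying [b] by [word_perm i] takes one step in the tree. *)
pose pt (b : 'I_#|{perm L.-bseq 'I_k}|) : seq 'I_k :=
  (enum_val b : {perm L.-bseq 'I_k}) ((enum_val b0 : {perm L.-bseq 'I_k})^-1%g [bseq]).
exists (fun b => ohead (pt b)), (fun j b => reduced (pt b) && (size (pt b) <= j)).
have ptE i b : pt (enum_rank (enum_val b * word_perm i)%g) = word_step i (pt b).
  by rewrite /pt enum_rankK permM permE.
split=> [|j b i jL /andP[rb sb]|j b i jL /andP[rb sb]].
- by rewrite /pt permKV.
- by rewrite ptE reduced_step //= (leq_trans (size_step_le _ _)).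
- by rewrite ptE ohead_step // (leq_ltn_trans sb).
Qed.

End LargeGirth.

(** * Resolvents and partial traces *)

Section Resolvent.
Variable R : realType.
Local Notation C := (R[i]).

(* [Z] is the resolvent (1 + S)^-1: its trace is bounded below by
   (1 + S)^-1 >= 1 - S. *)
Lemma resolvent m (S : 'M[C]_m) :
  (forall v w : 'rV[C]_m, ip (v *m S) w = ip v (w *m S)) ->
  (forall v : 'rV[C]_m, 0 <= ip (v *m S) v) ->
  exists Z : 'M[C]_m,
  [/\ forall v : 'rV[C]_m, hs (v *m Z) <= hs v,
      forall v : 'rV[C]_m, ip (v *m Z *m S) (v *m Z) *+ 2 <= hs v &
      m%:R - \sum_b ip (delta_mx 0 b *m S) (delta_mx 0 b : 'rV[C]_m)
        <= complex.Re (\tr Z)].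
Proof.
move=> Ssym Spos.
(* All terms on the right are nonnegative: this gives the invertibility of [1%:M + S] and, applied
   to [v *m Z], both norm bounds. *)
have G1 (v : 'rV[C]_m) : hs (v *m (1%:M + S)) = hs v + ip (v *m S) v *+ 2 + hs (v *m S).
  by rewrite mulmxDr mulmx1 hsD ipC.
have Gu : 1%:M + S \in unitmx.
  rewrite -row_free_unit; apply: inj_row_free => v v0.
  apply: hs_eq0; apply/eqP; rewrite eq_le hs_ge0 andbT.
  rewrite -(hs0 R 1 m) -v0 G1 -addrA lerDl addr_ge0 ?hs_ge0 //.
  by rewrite mulrn_wge0 ?Spos.
pose Z := invmx (1%:M + S).
have vE (v : 'rV[C]_m) : v = v *m Z *m (1%:M + S) by rewrite mulmxKV.
have ZS : Z = 1%:M - S *m Z.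
  by apply/eqP; rewrite -subr_eq0 opprB addrA -{1}[Z]mul1mx -mulmxDl mulmxV // subrr.
exists Z; split=> [v|v|].
- rewrite {2}[v]vE G1 -addrA lerDl addr_ge0 ?hs_ge0 //.
  by rewrite mulrn_wge0 ?Spos.
- by rewrite {3}[v]vE G1 addrC addrA lerDr addr_ge0 ?hs_ge0.
have -> : complex.Re (\tr Z) = \sum_b ip (delta_mx 0 b *m Z) (delta_mx 0 b : 'rV[C]_m).
  rewrite Re_sum; apply: eq_bigr => b _; rewrite /ip.
  have -> : adj (delta_mx 0 b : 'rV[C]_m) = delta_mx b 0.
    by apply/matrixP => i j; rewrite !mxE rmorph_nat andbC.
  by rewrite -rowE -colE /mxtrace big_ord1 !mxE.
have -> : m%:R = \sum_(b < m) 1 :> R by rewrite sumr_const card_ord.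
rewrite -sumrB; apply: ler_sum => b _.
set d : 'rV[C]_m := delta_mx 0 b.
have dd : ip d d = 1.
  rewrite -/(hs d) hsE big_ord1 (bigD1 b) //= big1 ?addr0 => [|j jb].
    by rewrite mxE !eqxx ComplexField.Normc.normc1 expr1n.
  by rewrite mxE (negbTE jb) andbF ComplexField.Normc.normc0 expr0n.
have E (w : 'rV[C]_m) : ip (w *m Z) w = hs (w *m Z) + ip (w *m Z *m S) (w *m Z).
  by rewrite {2}[w]vE mulmxDr mulmx1 ipDr -/(hs _) [ip (w *m Z) (_ *m S)]ipC.
(* The identity Z = 1 - S + S Z S at a basis vector; by [E] the last term is nonnegative. *)
have -> : ip (d *m Z) d = 1 - ip (d *m S) d + ip (d *m S *m Z) (d *m S).
  have e1 : d *m Z + d *m S *m Z = d by rewrite -mulmxA -mulmxDr {1}ZS subrK mulmx1.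
  have e2 : d *m Z + d *m Z *m S = d by rewrite [RHS]vE mulmxDr mulmx1.
  have h1 : ip (d *m Z) d + ip (d *m Z *m S) d = 1 by rewrite -ipDl e2.
  have h2 : ip (d *m Z) (d *m S) + ip (d *m S *m Z) (d *m S) = ip (d *m S) d.
    by rewrite -ipDl e1 ipC.
  rewrite -h2 -Ssym -h1; ring.
by rewrite lerDl E addr_ge0 ?hs_ge0 ?Spos.
Qed.

(* [S] is the partial trace over the first tensor factor of [Q ^ 2]. *)
Lemma partial_trace_form N m (Q : 'M[C]_(N, m) -> 'M[C]_(N, m)) :
  (forall a X Y, Q (a *: X + Y) = a *: Q X + Q Y) ->
  (forall X Y, ip (Q X) Y = ip X (Q Y)) ->
  exists S : 'M[C]_m, forall v w : 'rV[C]_m,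
    ip (v *m S) w =
    \sum_a ip (Q (delta_mx a (0 : 'I_1) *m v)) (Q (delta_mx a (0 : 'I_1) *m w)).
Proof.
move=> Qlin Qsa.
pose f (v : 'rV[C]_m) := \sum_a row a (Q (Q (delta_mx a (0 : 'I_1) *m v))).
have flin : linear f.
  move=> c v w; rewrite /f scaler_sumr -big_split; apply: eq_bigr => a _ /=.
  by rewrite mulmxDr -scalemxAr !Qlin linearP.
pose fL : {linear 'rV[C]_m -> 'rV[C]_m} :=
  HB.pack f (GRing.isLinear.Build _ _ _ _ f flin).
exists (lin1_mx fL) => v w; rewrite mul_rV_lin1 /= /f ip_suml.
apply: eq_bigr => a _; rewrite -Qsa [in RHS]ipC ip_mull ipC.
congr (ip _ _); rewrite rowE; congr (_ *m _).
by apply/matrixP => i j; rewrite !mxE rmorph_nat andbC.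
Qed.

End Resolvent.

(** * Powers of A^* A for the twist A *)

Section Powers.
Variable R : realType.
Local Notation C := (R[i]).
Variables (k m : nat) (p : 'I_k -> 'I_m -> 'I_m).
Hypothesis pK : forall i, involutive (p i).
Variables (N : nat) (y : 'I_k -> 'M[C]_N).
Hypothesis yc : contractive y.

Let y' i := adj (y i).

(** With w = y^* v, [hs w] is the pairing of v with y w, at most [hn v * hn w]; it remains to divide
    by [hn w]. *)
Lemma contractive_adj : contractive y'.
Proof.
move=> i v; rewrite /y'; set w := adj (y i) *m v.
have h : hs w <= hn v * hn w.
  rewrite {1}/hs {1}/w ip_mull adjK; apply: le_trans (ip_le _ _) _.
  rewrite ler_wpM2l ?hn_ge0 // -[leRHS]mul1r; apply: hn_le => //.
  by rewrite expr1n mul1r; exact: yc.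
have [w0|w0] := eqVneq (hn w) 0; first by rewrite (hn_eq0 w0) hs0 hs_ge0.
have wp : 0 < hn w by rewrite lt_def w0 hn_ge0.
rewrite -hn_sqr expr2 ler_pM2r // in h.
by rewrite -!hn_sqr ler_pXn2r ?nnegrE ?hn_ge0.
Qed.

Lemma twist_lin (z : 'I_k -> 'M[C]_N) a X Y :
  twist p z (a *: X + Y) = a *: twist p z X + twist p z Y.
Proof.
rewrite /twist scaler_sumr -big_split; apply: eq_bigr => i _ /=.
by rewrite mulmxDr mulmxDl -scalemxAr -scalemxAl.
Qed.

Lemma ip_twist (z : 'I_k -> 'M[C]_N) X Y :
  ip (twist p z X) Y = ip X (twist p (fun i => adj (z i)) Y).
Proof.
rewrite /twist ip_suml ip_sumr; apply: eq_bigr => i _.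
by rewrite ip_mulr (adj_umx _ pK) ip_mull mulmxA.
Qed.

(** The positive operator A^* A for A = [twist p y]; by [ip_twist] the adjoint of A is the twist by
    the adjoint matrices. *)
Definition twist2 (X : 'M[C]_(N, m)) := twist p y' (twist p y X).

Lemma ip_twist2 X Y : ip (twist2 X) Y = ip X (twist2 Y).
Proof.
rewrite /twist2 ip_twist.
have -> : (fun i => adj (y' i)) = y by apply/funext => i; rewrite /y' adjK.
by rewrite ip_twist.
Qed.

Lemma ip_twist2_self X : ip (twist2 X) X = hs (twist p y X).
Proof.
rewrite /twist2 ip_twist.
by have -> : (fun i => adj (y' i)) = y by apply/funext => i; rewrite /y' adjK.
Qed.

Lemma iter_twist2_lin n a X Y :
  iter n twist2 (a *: X + Y) = a *: iter n twist2 X + iter n twist2 Y.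
Proof. by elim: n => //= n ->; rewrite /twist2 !twist_lin. Qed.

Lemma iter_twist2_sa n X Y : ip (iter n twist2 X) Y = ip X (iter n twist2 Y).
Proof. by elim: n X Y => //= n IH X Y; rewrite ip_twist2 IH -iterSr. Qed.

(** For a self-adjoint T the squared norm of T^j X is the pairing of T^(2j) X with X. Squaring the
    bound and applying Cauchy-Schwarz doubles the exponent. *)
Lemma twist2_interpolation t X :
  hn (twist2 X) ^+ (2 ^ t) <= hn (iter (2 ^ t) twist2 X) * hn X ^+ (2 ^ t).-1.
Proof.
elim: t => [|t IH]; first by rewrite expn0 expr1 /= expr0 mulr1.
have s2 : (2 ^ t.+1 = 2 ^ t + 2 ^ t)%N by rewrite expnS mul2n addnn.
have t0 : (0 < 2 ^ t)%N by rewrite expn_gt0.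
have sq : hn (iter (2 ^ t) twist2 X) ^+ 2 <= hn (iter (2 ^ t.+1) twist2 X) * hn X.
  rewrite hn_sqr {1}/hs iter_twist2_sa -iterD -s2 mulrC; exact: ip_le.
rewrite {1}s2 exprD -expr2.
have h0 : 0 <= hn (twist2 X) ^+ (2 ^ t) by rewrite exprn_ge0 ?hn_ge0.
apply: le_trans (_ : (hn (iter (2 ^ t) twist2 X) * hn X ^+ (2 ^ t).-1) ^+ 2 <= _).
  by rewrite ler_pXn2r ?nnegrE // mulr_ge0 ?exprn_ge0 ?hn_ge0.
rewrite exprMn -exprM.
have -> : (2 ^ t.+1).-1 = ((2 ^ t).-1 * 2).+1 by rewrite s2; lia.
by rewrite [hn X ^+ _.+1]exprS mulrA ler_wpM2r ?exprn_ge0 ?hn_ge0.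
Qed.

(** Taking the root of order [2 ^ t] in the interpolation bounds A^* A at [X] by [c * h]; pairing
    with [X] then bounds A. *)
Lemma twist_le_of_power t X (h c : R) : 0 <= h -> 0 <= c -> hn X <= h ->
  hn (iter (2 ^ t) twist2 X) <= c ^+ (2 ^ t) * h -> hs (twist p y X) <= c * h ^+ 2.
Proof.
move=> h0 c0 hX hP.
have P1 : hn (twist2 X) <= c * h.
  rewrite -(@ler_pXn2r _ (2 ^ t)) ?nnegrE ?mulr_ge0 ?hn_ge0 ?expn_gt0 //.
  apply: le_trans (twist2_interpolation t X) _.
  have t0 : (0 < 2 ^ t)%N by rewrite expn_gt0.
  have -> : (c * h) ^+ (2 ^ t) = c ^+ (2 ^ t) * h * h ^+ (2 ^ t).-1.
    by rewrite exprMn -mulrA -exprS prednK.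
  apply: ler_pM => //; rewrite ?exprn_ge0 ?hn_ge0 //.
  by rewrite lerXn2r ?nnegrE ?hn_ge0.
rewrite -ip_twist2_self; apply: le_trans (ip_le _ _) _.
by rewrite expr2 mulrA ler_pM ?hn_ge0.
Qed.

Section Tree.
Variables (L : nat) (hd : 'I_m -> option 'I_k) (B : nat -> pred 'I_m).
Hypothesis BS : forall j b i, (j < L)%N -> B j b -> B j.+1 (p i b).
Hypothesis hdP : forall j b i, (j < L)%N -> B j b ->
  (hd (p i b) == Some i) = (hd b != Some i).

Lemma twist_supp (z : 'I_k -> 'M[C]_N) j X : (j < L)%N ->
  (forall b, ~~ B j b -> col b X = 0) ->
  forall b, ~~ B j.+1 b -> col b (twist p z X) = 0.
Proof.
move=> jL X0 b nB; rewrite col_twist //; apply: big1 => i _.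
rewrite X0 ?mulmx0 //; apply: contra nB => Bp.
by rewrite -(pK i b); exact: BS.
Qed.

(** Each twist enlarges the radius of the support by one and costs a factor [4 * k]; all [n.*2] of
    them stay within the radius where the graph looks like a tree. *)
Lemma iter_twist2_tree n j X : (j + n.*2 <= L)%N ->
  (forall b, ~~ B j b -> col b X = 0) ->
  hs (iter n twist2 X) <= (4 * k)%:R ^+ n.*2 * hs X.
Proof.
elim: n j X => [|n IH] j X jn X0; first by rewrite expr0 mul1r.
rewrite doubleS in jn *.
have jL : (j < L)%N by lia.
have jL1 : (j.+1 < L)%N by lia.
have X1 := twist_supp y jL X0; have X2 := twist_supp y' jL1 X1.
rewrite iterSr; apply: le_trans (IH j.+2 _ _ X2) _; first by lia.
rewrite 2!exprSr -2!mulrA ler_wpM2l ?exprn_ge0 ?ler0n //.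
apply: le_trans (twist_tree_le pK contractive_adj X1 (fun b i => hdP i jL1)) _.
rewrite ler_wpM2l ?ler0n //.
exact: (twist_tree_le pK yc X0 (fun b i => hdP i jL)).
Qed.

End Tree.
End Powers.

(** * Matrices that are small against a given list of tuples *)

Section Core.
Variable R : realType.
Local Notation C := (R[i]).
Variable k : nat.

(** A dependent pair, so that one list can mix matrix sizes. *)
Definition mxtuple := {N : nat & 'I_k -> 'M[C]_N}.

Definition total_size (s : seq mxtuple) : nat := \sum_(z <- s) projT1 z.

Lemma le_total_size N (y : 'I_k -> 'M[C]_N) (s : seq mxtuple) :
  List.In (existT _ N y) s -> (N <= total_size s)%N.
Proof.
rewrite /total_size; elim: s => //= z s IH; rewrite big_cons => -[->|/IH] /=; lia.
Qed.

Section Graph.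
Variables (m L n : nat) (p : 'I_k -> 'I_m -> 'I_m).
Hypothesis pK : forall i, involutive (p i).
Hypothesis girth : forall b0, exists (hd : 'I_m -> option 'I_k) (B : nat -> pred 'I_m),
  [/\ B 0%N b0, forall j b i, (j < L)%N -> B j b -> B j.+1 (p i b) &
      forall j b i, (j < L)%N -> B j b ->
        (hd (p i b) == Some i) = (hd b != Some i)].
Hypothesis nL : (n.*2 <= L)%N.

Lemma hs_delta N (a : 'I_N) (b : 'I_m) : hs (delta_mx a b : 'M[C]_(N, m)) = 1.
Proof.
rewrite hsE (bigD1 a) //= (bigD1 b) //= mxE !eqxx ComplexField.Normc.normc1 expr1n.
rewrite !big1 ?addr0 // => [i ia|j jb].
  by apply: big1 => j _; rewrite mxE (negbTE ia) ComplexField.Normc.normc0 expr0n.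
by rewrite mxE (negbTE jb) andbF ComplexField.Normc.normc0 expr0n.
Qed.

Lemma iter_twist2_delta N (y : 'I_k -> 'M[C]_N) a b : contractive y ->
  hs (iter n (twist2 p y) (delta_mx a b)) <= (4 * k)%:R ^+ n.*2.
Proof.
(* The support is the single vertex [b], which is taken as the root. *)
move=> yc; have [hd [B [B0 BS hdP]]] := girth b.
suff h c : ~~ B 0%N c -> col c (delta_mx a b : 'M[C]_(N, m)) = 0.
  by have := iter_twist2_tree pK yc BS hdP (j := 0) nL h; rewrite hs_delta mulr1.
move=> nB.
apply/matrixP => i j; rewrite !mxE; case: eqP => // _; case: eqP => // cb.
by rewrite cb B0 in nB.
Qed.

(** [S] is the sum, over the contractive tuples of [s], of the partial traces of (A^* A)^(2n). Its
    trace runs over elementary matrices, each supported at one vertex and so bounded by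
    [iter_twist2_delta]. *)
Lemma power_forms (s : seq mxtuple) : exists S : 'M[C]_m,
  [/\ forall v w : 'rV[C]_m, ip (v *m S) w = ip v (w *m S),
      forall v : 'rV[C]_m, 0 <= ip (v *m S) v,
      forall z : mxtuple, List.In z s -> contractive (projT2 z) ->
        forall v : 'rV[C]_m,
        \sum_a hs (iter n (twist2 p (projT2 z)) (delta_mx a (0 : 'I_1) *m v)) <= ip (v *m S) v &
      \sum_b ip (delta_mx 0 b *m S) (delta_mx 0 b : 'rV[C]_m)
        <= m%:R * (total_size s)%:R * (4 * k)%:R ^+ n.*2].
Proof.
elim: s => [|[N y] s [S [Ssym Spos Sge Str]]].
  exists 0; split=> //= [v w|v|].
  - by rewrite !mulmx0 ip0l ipC ip0l.
  - by rewrite mulmx0 ip0l.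
  - rewrite big1 ?mulr_ge0 ?ler0n ?exprn_ge0 // => b _.
    by rewrite mulmx0 ip0l.
have tE : total_size (existT _ N y :: s) = (N + total_size s)%N.
  by rewrite /total_size big_cons.
have [yc|nyc] := pselect (contractive y); last first.
  exists S; split=> // [z [<- //|]|]; first exact: Sge.
  apply: le_trans Str _; rewrite tE ler_wpM2r ?exprn_ge0 ?ler0n //.
  by rewrite ler_wpM2l ?ler0n // ler_nat leq_addl.
have [S1 S1E] := partial_trace_form (iter_twist2_lin p y n) (iter_twist2_sa pK y n).
have S1pos (v : 'rV[C]_m) : 0 <= ip (v *m S1) v.
  by rewrite S1E; apply: sumr_ge0 => a _; exact: hs_ge0.
exists (S1 + S); split=> [v w|v|z hin zc v|].
- rewrite !mulmxDr ipDl ipDr Ssym; congr (_ + _).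
  by rewrite [RHS]ipC !S1E; apply: eq_bigr => a _; rewrite ipC.
- by rewrite mulmxDr ipDl addr_ge0.
- rewrite mulmxDr ipDl; case: hin => [<-|hin].
    by rewrite S1E lerDl.
  by apply: le_trans (Sge _ hin zc v) _; rewrite lerDr.
rewrite tE natrD mulrDr mulrDl.
under eq_bigr do rewrite mulmxDr ipDl.
rewrite big_split /=; apply: lerD => //.
have -> : m%:R * N%:R * (4 * k)%:R ^+ n.*2
    = \sum_(b < m) \sum_(a < N) (4 * k)%:R ^+ n.*2 :> R.
  by rewrite !sumr_const !card_ord -mulrA !mulr_natl.
apply: ler_sum => b _; rewrite S1E; apply: ler_sum => a _.
by rewrite mul_delta_mx; exact: iter_twist2_delta.
Qed.

End Graph.

Lemma mulmx_sum_delta N m (X : 'M[C]_(N, m)) :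
  X = \sum_a delta_mx a (0 : 'I_1) *m row a X.
Proof.
apply/matrixP => i j; rewrite summxE (bigD1 i) //= big1 ?addr0 => [|a ai].
  by rewrite mxE big_ord1 !mxE !eqxx mul1r.
by rewrite mxE big_ord1 !mxE eq_sym (negbTE ai) mul0r.
Qed.

(** A finite form of the non-exactness of l_1^k. The [a i] are the [umx i] compressed by a resolvent
    [Z] and divided by [beta], whose square [8 * k] is twice the tree bound [4 * k]. *)
Lemma separating_tuple (beta : R) (s : seq mxtuple) :
  1 <= beta -> (8 * k)%:R = beta ^+ 2 -> 8 * beta < k%:R ->
  exists m (a : 'I_k -> 'M[C]_m),
  [/\ forall i n (xi : 'M[C]_(n, m)), hn (xi *m a i) <= hn xi,
      forall z : mxtuple, List.In z s -> contractive (projT2 z) ->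
        forall xi, hn (\sum_i projT2 z i *m xi *m a i) <= hn xi &
      exists (u : 'I_k -> 'M[C]_m) (xi : 'M[C]_m),
        contractive u /\ 4 * hn xi < hn (\sum_i u i *m xi *m a i)].
Proof.
move=> b1 bE bk.
have b0 : 0 < beta by exact: lt_le_trans b1.
(* [M] exceeds every size in [s], and [n] is the order of the root taken in the interpolation. Since
   [M <= 2 ^ n], the factors [M] are paid for by passing from [4 * k] to [8 * k]. *)
pose M := (total_size s).+1.
pose n := (2 ^ M)%N.
have Mn : (M <= 2 ^ n)%N.
  by apply: ltnW; apply: leq_ltn_trans (ltn_expl n _) => //; exact/ltnW/ltn_expl.
have [m [p [m0 pK girth]]] := large_girth k n.*2.
have [S [Ssym Spos Sge Str]] := power_forms pK girth (leqnn _) s.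
(* With this constant the trace of [S] divided by [c] is at most [m / 2], so the resolvent keeps
   half of the trace. *)
pose c : R := 2 * M%:R * (4 * k)%:R ^+ n.*2.
have k0 : (0 < k)%N by rewrite -(ltr0n R); apply: lt_trans bk; rewrite mulr_gt0.
have q0 : 0 < (4 * k)%:R ^+ n.*2 :> R by rewrite exprn_gt0 // ltr0n muln_gt0.
have c0 : 0 < c by rewrite !mulr_gt0 ?ltr0n.
pose S' := ((c^-1)%:C)%C *: S.
have S'E (v w : 'rV[C]_m) : ip (v *m S') w = c^-1 * ip (v *m S) w.
  by rewrite /S' -scalemxAr ipZl.
have [Z [Zle ZS Ztr]] : exists Z : 'M[C]_m,
  [/\ forall v : 'rV[C]_m, hs (v *m Z) <= hs v,
      forall v : 'rV[C]_m, ip (v *m Z *m S') (v *m Z) *+ 2 <= hs v &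
      m%:R - \sum_b ip (delta_mx 0 b *m S') (delta_mx 0 b : 'rV[C]_m)
        <= complex.Re (\tr Z)].
  apply: resolvent => [v w|v]; rewrite S'E; last by rewrite mulr_ge0 ?invr_ge0 // ltW.
  by rewrite [RHS]ipC S'E Ssym ipC.
have ZleM N (xi : 'M[C]_(N, m)) : hs (xi *m Z) <= hs xi.
  by rewrite !hs_rows; apply: ler_sum => i _; rewrite row_mul.
have trZ : m%:R / 2 <= complex.Re (\tr Z).
  apply: le_trans Ztr; under eq_bigr do rewrite S'E.
  rewrite -mulr_sumr.
  suff : c^-1 * \sum_b ip (delta_mx 0 b *m S) (delta_mx 0 b : 'rV[C]_m) <= m%:R / 2 by lra.
  rewrite ler_pdivrMl //; apply: le_trans Str _.
  have -> : c * (m%:R / 2) = m%:R * M%:R * (4 * k)%:R ^+ n.*2 by rewrite /c; field.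
  by rewrite ler_wpM2r ?(ltW q0) // ler_wpM2l ?ler0n // ler_nat.
have twist_le z (xi : 'M[C]_(_, m)) : List.In z s -> contractive (projT2 z) ->
    hs (twist p (projT2 z) (xi *m Z)) <= beta ^+ 2 * hs xi.
  move=> hin zc; rewrite -bE -[hs xi]hn_sqr.
  apply: (twist_le_of_power pK (t := M)); rewrite ?hn_ge0 ?ler0n //.
    by rewrite -[leRHS]mul1r; apply: hn_le => //; rewrite expr1n mul1r.
  apply: hn_le; first by rewrite exprn_ge0 ?ler0n.
  rewrite -/n; set Q := iter n _; set X := xi *m Z.
  have QD : Q X = \sum_a Q (delta_mx a (0 : 'I_1) *m row a X).
    rewrite {1}[X]mulmx_sum_delta; apply: (big_morph Q) => [U V|].
      by have := iter_twist2_lin p (projT2 z) n 1 U V; rewrite !scale1r.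
    by have := iter_twist2_lin p (projT2 z) n (-1) 0 0; rewrite scaler0 addr0 scaleN1r addNr.
  rewrite QD; apply: le_trans (hs_sum_le _) _; rewrite card_ord.
  have Nz : (projT1 z <= M)%N by case: z hin {xi zc Q X QD} => N y /le_total_size /leqW.
  (* By [Sge] the form [S] dominates the power on the tensor of a basis vector with a row, and
     compression by [Z] bounds that form by [c / 2] times the squared norm. *)
  have row_le a : hs (Q (delta_mx a (0 : 'I_1) *m row a X)) <= c / 2 * hs (row a xi).
    apply: le_trans (_ : ip (row a X *m S) (row a X) <= _).
      apply: le_trans (Sge _ hin zc (row a X)).
      by rewrite [leRHS](bigD1 a) //= lerDl sumr_ge0 // => j _; exact: hs_ge0.
    have := ZS (row a xi); rewrite S'E /X row_mul => h.
    rewrite mulrC mulrA ler_pdivlMr // -ler_pdivrMr //.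
    by apply: le_trans h; rewrite mulr_natr mulrC mulrnAr.
  apply: le_trans (_ : M%:R * (c / 2 * hs xi) <= _).
    apply: ler_pM; rewrite ?ler0n ?ler_nat //.
      by apply: sumr_ge0 => a _; exact: hs_ge0.
    by rewrite [hs xi]hs_rows mulr_sumr; apply: ler_sum => a _.
  rewrite mulrA ler_wpM2r ?hs_ge0 //.
  have -> : M%:R * (c / 2) = M%:R ^+ 2 * (4 * k)%:R ^+ n.*2 by rewrite /c; field.
  have -> : (8 * k)%:R = 2 * (4 * k)%:R :> R by rewrite -natrM; congr _%:R; lia.
  rewrite exprMn exprMn -(exprM (4 * k)%:R n 2) muln2 ler_wpM2r ?(ltW q0) //.
  by rewrite ler_pXn2r ?nnegrE ?ler0n ?exprn_ge0 // -natrX ler_nat.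
have bb : normc ((beta^-1)%:C)%C = beta^-1 :> R.
  by rewrite normc_real ger0_norm // invr_ge0 ltW.
pose a i : 'M[C]_m := ((beta^-1)%:C)%C *: (Z *m umx R p i).
have aE N (z : 'I_k -> 'M[C]_N) (xi : 'M[C]_(N, m)) :
    \sum_i z i *m xi *m a i = ((beta^-1)%:C)%C *: twist p z (xi *m Z).
  rewrite /twist scaler_sumr; apply: eq_bigr => i _.
  by rewrite /a -scalemxAr !mulmxA.
exists m, a; split=> [i N xi|z hin zc xi|].
- rewrite /a -scalemxAr hnZ bb ler_pdivrMl // mulmxA.
  apply: hn_le; first exact: ltW.
  rewrite hs_mul_umx //; apply: le_trans (ZleM _ _) _.
  by rewrite ler_peMl ?hs_ge0 // exprn_ege1.
- rewrite aE hnZ bb ler_pdivrMl //; apply: hn_le; first exact: ltW.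
  exact: twist_le.
exists (umx R p), 1%:M; split=> [i v|]; first by rewrite hs_umx_mul.
rewrite aE hnZ bb mul1mx.
have h1 : hn (1%:M : 'M[C]_m) ^+ 2 = m%:R.
  by rewrite hn_sqr /hs /ip adj_one mulmx1 mxtrace1 -[m%:R]/(_) -(rmorph_nat (real_complex R)).
have h1p : 0 < hn (1%:M : 'M[C]_m).
  by rewrite lt_def hn_ge0 andbT; apply/eqP => e; move: m0; rewrite -(ltr0n R) -h1 e expr0n ltxx.
(* The [umx i] square to the identity, so this pairing is at least [k * m / 2], while [hs 1%:M] is
   [m]. The norm of the sum is thus at least [k / (2 * beta)] times [hn 1%:M], and
   [8 * beta < k]. *)
have tr : ip (twist p (umx R p) Z) 1%:M = k%:R * complex.Re (\tr Z).
  rewrite /twist ip_suml mulr_natl -[k in RHS]card_ord -sumr_const; apply: eq_bigr => i _.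
  by rewrite /ip adj_one mulmx1 mxtrace_mulC mulmxA umxK // mul1mx.
have le1 := ip_le (twist p (umx R p) Z) 1%:M; rewrite tr in le1.
rewrite ltr_pdivlMl // -(ltr_pM2r h1p).
apply: lt_le_trans le1.
rewrite -!mulrA -expr2 h1.
apply: lt_le_trans (_ : k%:R * (m%:R / 2) <= _); last by rewrite ler_wpM2l ?ler0n.
have mp : 0 < m%:R :> R by rewrite ltr0n.
rewrite [ltRHS]mulrCA [ltLHS]mulrA [ltLHS]mulrC ltr_pM2l //; lra.
Qed.

End Core.

(** * Operator spaces normed by maps into matrix algebras *)

Section ConcreteOperatorSpace.
Variable R : realType.
Local Notation C := (R[i]).
Variables (V : lmodType C) (J : Type) (d : J -> nat).
Variable theta : forall j, {linear V -> 'M[C]_(d j)}.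

(** A vector of C^n tensor C^(d j) is written as an [n] by [d j] matrix: the entries of [x] act on
    its rows from the right through [theta j], while the matrix indices of [x] act from the left. *)
Definition amp j n p (x : 'M[V]_(p, n)) (xi : 'M[C]_(n, d j)) : 'M[C]_(p, d j) :=
  \matrix_(a < p) \sum_(l < n) row l xi *m theta j (x a l).

Definition amp_norm n (x : 'M[V]_n) : R :=
  sup [set r | exists j (xi : 'M[C]_(n, d j)), hn xi <= 1 /\ r = hn (amp x xi)]%classic.

Lemma row_amp j n p (x : 'M[V]_(p, n)) (xi : 'M[C]_(n, d j)) a :
  row a (amp x xi) = \sum_(l < n) row l xi *m theta j (x a l).
Proof. exact: rowK. Qed.

Lemma ampDl j n p (x y : 'M[V]_(p, n)) (xi : 'M[C]_(n, d j)) :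
  amp (x + y) xi = amp x xi + amp y xi.
Proof.
apply/row_matrixP => a; rewrite linearD /= !row_amp -big_split.
by apply: eq_bigr => l _; rewrite mxE linearD mulmxDr.
Qed.

Lemma ampZl j n p c (x : 'M[V]_(p, n)) (xi : 'M[C]_(n, d j)) :
  amp (map_mx (fun v => c *: v) x) xi = c *: amp x xi.
Proof.
apply/row_matrixP => a; rewrite linearZ /= !row_amp scaler_sumr.
by apply: eq_bigr => l _; rewrite mxE linearZ -scalemxAr.
Qed.

Lemma ampZr j n p c (x : 'M[V]_(p, n)) (xi : 'M[C]_(n, d j)) :
  amp x (c *: xi) = c *: amp x xi.
Proof.
apply/row_matrixP => a; rewrite linearZ /= !row_amp scaler_sumr.
by apply: eq_bigr => l _; rewrite linearZ /= -scalemxAl.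
Qed.

Lemma amp_lsmul j n m p (a : 'M[C]_(n, m)) (x : 'M[V]_(m, p)) (xi : 'M[C]_(p, d j)) :
  amp (lsmul a x) xi = a *m amp x xi.
Proof.
apply/row_matrixP => i; rewrite row_mul mulmx_sum_row row_amp.
under [RHS]eq_bigr do rewrite row_amp mxE scaler_sumr.
rewrite exchange_big; apply: eq_bigr => l _; rewrite mxE linear_sum mulmx_sumr /=.
by apply: eq_bigr => b _; rewrite linearZ -scalemxAr.
Qed.

Lemma amp_rsmul j n m p (x : 'M[V]_(n, m)) (b : 'M[C]_(m, p)) (xi : 'M[C]_(p, d j)) :
  amp (rsmul x b) xi = amp x (b *m xi).
Proof.
apply/row_matrixP => i; rewrite !row_amp.
under [RHS]eq_bigr => c _ do rewrite row_mul (mulmx_sum_row (row c b)) mulmx_suml.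
rewrite exchange_big; apply: eq_bigr => l _; rewrite mxE linear_sum mulmx_sumr /=.
by apply: eq_bigr => a _; rewrite linearZ -scalemxAr mxE -scalemxAl.
Qed.

Lemma amp_block j m n (x : 'M[V]_m) (y : 'M[V]_n)
    (xi : 'M[C]_(m, d j)) (eta : 'M[C]_(n, d j)) :
  amp (block_mx x 0 0 y) (col_mx xi eta) = col_mx (amp x xi) (amp y eta).
Proof.
apply/row_matrixP => i; rewrite row_amp big_split_ord /=.
case: (split_ordP i) => a ->; rewrite ?(rowKu, rowKd) row_amp.
  rewrite [X in _ + X]big1 ?addr0 => [|l _]; last by rewrite block_mxEur mxE linear0 mulmx0.
  by apply: eq_bigr => l _; rewrite block_mxEul rowKu.
rewrite [X in X + _]big1 ?add0r => [|l _]; last by rewrite block_mxEdl mxE linear0 mulmx0.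
by apply: eq_bigr => l _; rewrite block_mxEdr rowKd.
Qed.

Hypothesis j0 : J.
Hypothesis theta_bounded : forall v, exists2 M : R, 0 <= M &
  forall j (w : 'rV[C]_(d j)), hn (w *m theta j v) <= M * hn w.
Hypothesis theta_sep : forall v, (forall j, theta j v = 0) -> v = 0.

(** The bounds of all entries are added up; this makes the supremum in [amp_norm] finite. *)
Lemma amp_bounded n (x : 'M[V]_n) : exists2 M : R, 0 <= M &
  forall j (xi : 'M[C]_(n, d j)), hn (amp x xi) <= M * hn xi.
Proof.
have [M MP] : exists M : 'I_n -> 'I_n -> R, forall a l, 0 <= M a l /\
    forall j (w : 'rV[C]_(d j)), hn (w *m theta j (x a l)) <= M a l * hn w.
  have /choice[f fP] : forall al : 'I_n * 'I_n, exists M : R, 0 <= M /\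
      forall j (w : 'rV[C]_(d j)), hn (w *m theta j (x al.1 al.2)) <= M * hn w.
    by move=> al; have [M M0 MP] := theta_bounded (x al.1 al.2); exists M.
  by exists (fun a l => f (a, l)) => a l; exact: fP.
exists (\sum_a \sum_l M a l).
  by apply: sumr_ge0 => a _; apply: sumr_ge0 => l _; case: (MP a l).
move=> j xi; rewrite [amp x xi]mulmx_sum_delta mulr_suml.
apply: le_trans (hn_sum _ _ _) _; apply: ler_sum => a _.
have -> : hn (delta_mx a (0 : 'I_1) *m row a (amp x xi)) = hn (row a (amp x xi)).
  rewrite /hn; congr Num.sqrt; rewrite hs_rows (bigD1 a) //= big1 ?addr0 => [|b ba].
    congr hs; rewrite row_mul; apply/matrixP => i l.
    by rewrite !mxE big_ord1 !mxE !eqxx mul1r.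
  rewrite (_ : row b _ = 0) ?hs0 //; apply/matrixP => i l.
  by rewrite !mxE big_ord1 !mxE (negbTE ba) mul0r.
rewrite row_amp mulr_suml; apply: le_trans (hn_sum _ _ _) _.
apply: ler_sum => l _; case: (MP a l) => M0 h; apply: le_trans (h _ _) _.
by rewrite ler_wpM2l ?hn_row_le.
Qed.

Lemma amp_norm_ge n (x : 'M[V]_n) j (xi : 'M[C]_(n, d j)) :
  hn (amp x xi) <= amp_norm x * hn xi.
Proof.
have [M M0 MP] := amp_bounded x.
have [xi0|xi0] := eqVneq (hn xi) 0.
  by rewrite xi0 mulr0; apply: le_trans (MP _ _) _; rewrite xi0 mulr0.
have xip : 0 < hn xi by rewrite lt_def xi0 hn_ge0.
rewrite -ler_pdivrMr // mulrC.
have nE : normc (((hn xi)^-1)%:C)%C = (hn xi)^-1 by rewrite normc_real ger0_norm // invr_ge0 ltW.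
apply: ub_le_sup; last first.
  exists j, ((((hn xi)^-1)%:C)%C *: xi); rewrite ampZr !hnZ nE; split=> //.
  by rewrite mulVf.
exists M => _ [j' [xi' [h1 ->]]]; apply: le_trans (MP _ _) _.
by rewrite ler_piMr.
Qed.

Lemma amp_norm_le n (x : 'M[V]_n) c : 0 <= c ->
  (forall j (xi : 'M[C]_(n, d j)), hn (amp x xi) <= c * hn xi) -> amp_norm x <= c.
Proof.
move=> c0 h; apply: ge_sup.
  by exists (hn (amp x (0 : 'M[C]_(n, d j0)))), j0, 0; rewrite hn0.
move=> _ [j [xi [h1 ->]]]; apply: le_trans (h _ _) _.
by rewrite ler_piMr.
Qed.

Lemma amp_norm_ge0 n (x : 'M[V]_n) : 0 <= amp_norm x.
Proof.
apply: ub_le_sup.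
  have [M M0 MP] := amp_bounded x; exists M => _ [j' [xi' [h1 ->]]].
  by apply: le_trans (MP _ _) _; rewrite ler_piMr.
exists j0, 0; rewrite hn0; split=> //.
suff -> : amp x (0 : 'M[C]_(n, d j0)) = 0 by rewrite hn0.
by rewrite -[X in amp _ X](scale0r (0 : 'M[C]_(n, d j0))) ampZr scale0r.
Qed.

Lemma amp_norm_eq0 n (x : 'M[V]_n) : amp_norm x = 0 -> x = 0.
Proof.
move=> x0; apply/matrixP => a l; rewrite mxE; apply: theta_sep => j.
apply/row_matrixP => b; rewrite row0.
(* The elementary matrix at [(l, b)] isolates row [b] of [theta j (x a l)]. *)
have := amp_norm_ge x (delta_mx l b : 'M[C]_(n, d j)); rewrite x0 mul0r => h.
have /hn_eq0 e : hn (amp x (delta_mx l b : 'M[C]_(n, d j))) = 0.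
  by apply/eqP; rewrite eq_le h hn_ge0.
move/(congr1 (row a)): e; rewrite row0 row_amp (bigD1 l) //= big1 ?addr0.
  by rewrite rowE mul_delta_mx -rowE.
by move=> l' l'l; rewrite rowE mul_delta_mx_cond (negbTE l'l) mulr0n mul0mx.
Qed.

Lemma amp_normD n (x y : 'M[V]_n) : amp_norm (x + y) <= amp_norm x + amp_norm y.
Proof.
apply: amp_norm_le => [|j xi]; first by rewrite addr_ge0 ?amp_norm_ge0.
rewrite ampDl mulrDl; apply: le_trans (hnD _ _) _.
by apply: lerD; exact: amp_norm_ge.
Qed.

Lemma amp_normZ n c (x : 'M[V]_n) :
  amp_norm (map_mx (fun v => c *: v) x) = normc c * amp_norm x.
Proof.
have le1 a (z : 'M[V]_n) : amp_norm (map_mx (fun v => a *: v) z) <= normc a * amp_norm z.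
  apply: amp_norm_le => [|j xi]; first by rewrite mulr_ge0 ?normc_ge0 ?amp_norm_ge0.
  by rewrite ampZl hnZ -mulrA ler_wpM2l ?normc_ge0 ?amp_norm_ge.
apply/eqP; rewrite eq_le le1 /=.
have [->|c0] := eqVneq c 0.
  by rewrite ComplexField.Normc.normc0 mul0r amp_norm_ge0.
have nc : 0 < normc c.
  rewrite lt_def normc_ge0 andbT; apply/eqP => /ComplexField.Normc.eq0_normc e.
  by rewrite e eqxx in c0.
(* Scaling back by the inverse of [c] turns the upper bound into the lower one. *)
have := le1 c^-1 (map_mx (fun v => c *: v) x).
have -> : map_mx (fun v => c^-1 *: v) (map_mx (fun v => c *: v) x) = x.
  by apply/matrixP => a l; rewrite !mxE scalerA mulVf // scale1r.
by rewrite ComplexField.Normc.normcV ler_pdivlMl.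
Qed.

Lemma amp_norm_mul m n (a : 'M[C]_(n, m)) (x : 'M[V]_m) (b : 'M[C]_(m, n)) (ca cb : R) :
  opnorm_le a ca -> opnorm_le b cb ->
  amp_norm (rsmul (lsmul a x) b) <= ca * amp_norm x * cb.
Proof.
move=> ha hb; have [ca0 _] := ha; have [cb0 _] := hb.
apply: amp_norm_le => [|j xi]; first by rewrite !mulr_ge0 ?amp_norm_ge0.
rewrite amp_rsmul amp_lsmul; apply: le_trans (opnorm_le_hn _ ha) _.
rewrite -!mulrA ler_wpM2l //; apply: le_trans (amp_norm_ge _ _) _.
by rewrite ler_wpM2l ?amp_norm_ge0 // opnorm_le_hn.
Qed.

(** The squared norms of the two halves of a vector add, and a vector supported in one half meets
    only one block. *)
Lemma amp_norm_block m n (x : 'M[V]_m) (y : 'M[V]_n) :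
  amp_norm (block_mx x 0 0 y) = Num.max (amp_norm x) (amp_norm y).
Proof.
have hs_le p (z : 'M[V]_p) j (xi : 'M[C]_(p, d j)) :
    hs (amp z xi) <= amp_norm z ^+ 2 * hs xi.
  by rewrite -!hn_sqr -exprMn ler_pXn2r ?nnegrE ?mulr_ge0 ?hn_ge0 ?amp_norm_ge0 ?amp_norm_ge.
have hncol j (xi : 'M[C]_(m, d j)) : hn (col_mx xi (0 : 'M[C]_(n, d j))) = hn xi.
  by rewrite /hn hs_col_mx hs0 addr0.
have hncol' j (xi : 'M[C]_(n, d j)) : hn (col_mx (0 : 'M[C]_(m, d j)) xi) = hn xi.
  by rewrite /hn hs_col_mx hs0 add0r.
set M := Num.max _ _.
have M0 : 0 <= M by rewrite le_max amp_norm_ge0.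
apply/eqP; rewrite eq_le; apply/andP; split.
  apply: amp_norm_le => // j xi; rewrite -[xi]vsubmxK amp_block.
  apply: hn_le => //; rewrite !hs_col_mx mulrDr; apply: lerD;
    apply: le_trans (hs_le _ _ _ _) _; rewrite ler_wpM2r ?hs_ge0 //;
    by rewrite ler_pXn2r ?nnegrE ?amp_norm_ge0 // le_max lexx ?orbT.
rewrite ge_max; apply/andP; split; apply: amp_norm_le; rewrite ?amp_norm_ge0 // => j xi.
  have := amp_norm_ge (block_mx x 0 0 y) (col_mx xi 0); rewrite hncol; apply: le_trans.
  rewrite amp_block -[leRHS]mul1r; apply: hn_le => //.
  by rewrite expr1n mul1r hs_col_mx lerDl hs_ge0.
have := amp_norm_ge (block_mx x 0 0 y) (col_mx 0 xi); rewrite hncol'; apply: le_trans.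
rewrite amp_block -[leRHS]mul1r; apply: hn_le => //.
by rewrite expr1n mul1r hs_col_mx lerDr hs_ge0.
Qed.

Lemma amp_operator_space : is_operator_space (@amp_norm).
Proof.
split; first split.
- exact: amp_norm_ge0.
- exact: amp_norm_eq0.
- exact: amp_normD.
- exact: amp_normZ.
move=> m n x y; split; first exact: amp_norm_block.
by move=> m' n' a x' b ca cb; exact: amp_norm_mul.
Qed.

End ConcreteOperatorSpace.

(** * Uniform limits of Cauchy sequences *)

Section Limits.
Variable R : realType.
Local Notation C := (R[i]).

(** The limit is the supremum of the eventual lower bounds. It is fixed before [N] and [e], so each
    Cauchy estimate passes to it with the same [N]; this is what makes coordinatewise limits uniform
    in the next lemma. *)
Lemma real_cauchy_limit (u : nat -> R) :
  (forall e, 0 < e -> exists N, forall i j, (N <= i)%N -> (N <= j)%N -> `|u i - u j| <= e) ->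
  exists l, forall N e, (forall i j, (N <= i)%N -> (N <= j)%N -> `|u i - u j| <= e) ->
    forall i, (N <= i)%N -> `|u i - l| <= e.
Proof.
move=> uc.
pose A := [set x | exists N, forall i, (N <= i)%N -> x <= u i]%classic.
have low N e : (forall i j, (N <= i)%N -> (N <= j)%N -> `|u i - u j| <= e) ->
    forall i, (N <= i)%N -> A (u i - e).
  move=> h i Ni; exists N => j Nj; have := h _ _ Ni Nj.
  by rewrite ler_norml => /andP[_]; lra.
have up N e : (forall i j, (N <= i)%N -> (N <= j)%N -> `|u i - u j| <= e) ->
    forall i, (N <= i)%N -> ubound A (u i + e).
  move=> h i Ni x [N' hx]; have := hx _ (leq_maxr N N').
  have := h _ _ (leq_maxl N N') Ni; rewrite ler_norml => /andP[_].
  lra.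
have [N1 h1] := uc 1 ltr01.
exists (sup A) => N e h i Ni.
have hsA : has_sup A.
  split; first by exists (u N1 - 1); exact: (low N1).
  by exists (u N1 + 1); exact: (up N1).
have := sup_upper_bound hsA (low _ _ h _ Ni).
have := ge_sup hsA.1 (up _ _ h _ Ni).
by rewrite ler_norml => *; apply/andP; split; lra.
Qed.

Lemma uniform_cauchy_limit (I : Type) (u : nat -> I -> C) :
  (forall e, 0 < e -> exists N, forall k l, (N <= k)%N -> (N <= l)%N ->
     forall i, normc (u k i - u l i) <= e) ->
  exists f : I -> C, forall e, 0 < e -> exists N, forall k, (N <= k)%N ->
     forall i, normc (u k i - f i) <= e.
Proof.
move=> uc.
have ReB (x y : C) : complex.Re (x - y) = complex.Re x - complex.Re y by case: x y => [? ?] [? ?].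
have ImB (x y : C) : complex.Im (x - y) = complex.Im x - complex.Im y by case: x y => [? ?] [? ?].
have Re_le (x : C) : `|complex.Re x| <= normc x.
  rewrite -(@ler_pXn2r _ 2) ?nnegrE ?normc_ge0 // real_normK ?num_real //.
  by rewrite normc_sqr lerDl sqr_ge0.
have Im_le (x : C) : `|complex.Im x| <= normc x.
  rewrite -(@ler_pXn2r _ 2) ?nnegrE ?normc_ge0 // real_normK ?num_real //.
  by rewrite normc_sqr lerDr sqr_ge0.
have normc_le (x : C) : normc x <= `|complex.Re x| + `|complex.Im x|.
  rewrite -(@ler_pXn2r _ 2) ?nnegrE ?normc_ge0 ?addr_ge0 //.
  by rewrite normc_sqr sqrrD !real_normK ?num_real // lerD2r lerDl mulrn_wge0 ?mulr_ge0.
have /choice[fr frP] : forall i, exists l, forall N e,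
    (forall k j, (N <= k)%N -> (N <= j)%N -> `|complex.Re (u k i) - complex.Re (u j i)| <= e) ->
    forall k, (N <= k)%N -> `|complex.Re (u k i) - l| <= e.
  move=> i; apply: real_cauchy_limit => e /uc[N h]; exists N => k l Nk Nl.
  by rewrite -ReB; apply: le_trans (Re_le _) _; exact: h.
have /choice[fi fiP] : forall i, exists l, forall N e,
    (forall k j, (N <= k)%N -> (N <= j)%N -> `|complex.Im (u k i) - complex.Im (u j i)| <= e) ->
    forall k, (N <= k)%N -> `|complex.Im (u k i) - l| <= e.
  move=> i; apply: real_cauchy_limit => e /uc[N h]; exists N => k l Nk Nl.
  by rewrite -ImB; apply: le_trans (Im_le _) _; exact: h.
exists (fun i => Complex (fr i) (fi i)) => e e0.
have [|N h] := uc (e / 2); first by rewrite divr_gt0.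
exists N => k Nk i; apply: le_trans (normc_le _) _; rewrite ReB ImB /=.
have -> : e = e / 2 + e / 2 by field.
apply: lerD.
  apply: (frP i N) => // a b Na Nb; rewrite -ReB; apply: le_trans (Re_le _) _; exact: h.
apply: (fiP i N) => // a b Na Nb; rewrite -ImB; apply: le_trans (Im_le _) _; exact: h.
Qed.

End Limits.

(** * The space l_infinity^k and the module of convergent families *)

Section Spaces.
Variable R : realType.
Local Notation C := (R[i]).
Variable k : nat.
Hypothesis k0 : (0 < k)%N.
Local Notation F := ('rV[C]_k).

Definition coordF (i : 'I_k) (v : F) : 'M[C]_1 := (v 0 i)%:M.

Lemma coordF_linear i : linear (coordF i).
Proof. by move=> c v w; rewrite /coordF !mxE raddfD /= scale_scalar_mx. Qed.

HB.instance Definition _ i :=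
  GRing.isLinear.Build C F 'M[C]_1 _ (coordF i) (coordF_linear i).

(** Norming by the coordinates alone gives l_infinity^k: the largest operator norm among the
    [crdF i y]. *)
Definition normF : forall n, 'M[F]_n -> R :=
  @amp_norm R F 'I_k (fun=> 1%N) (fun i => coordF i : {linear F -> 'M[C]_1}).

Definition crdF n i (y : 'M[F]_n) : 'M[C]_n := map_mx (fun v : F => v 0 i) y.

Lemma amp_coordF n i (y : 'M[F]_n) (xi : 'cV[C]_n) :
  @amp R F 'I_k (fun=> 1%N) (fun i => coordF i : {linear F -> 'M[C]_1}) i _ _ y xi
  = crdF i y *m xi.
Proof.
apply/row_matrixP => a; rewrite row_amp row_mul mulmx_sum_row.
by apply: eq_bigr => l _; rewrite !mxE /= /coordF mul_mx_scalar.
Qed.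

Lemma hn_scalar n (X : 'M[C]_(n, 1)) c : hn (X *m c%:M) = normc c * hn X.
Proof. by rewrite mul_mx_scalar hnZ. Qed.

Lemma coordF_bounded (v : F) : exists2 M : R, 0 <= M &
  forall i (w : 'rV[C]_1), hn (w *m coordF i v) <= M * hn w.
Proof.
exists (\sum_i normc (v 0 i)); first by apply: sumr_ge0 => i _; exact: normc_ge0.
move=> i w; rewrite hn_scalar ler_wpM2r ?hn_ge0 //.
by rewrite (bigD1 i) //= lerDl sumr_ge0 // => j _; exact: normc_ge0.
Qed.

Let i0 : 'I_k := Ordinal k0.

Lemma normF_ge0 n (y : 'M[F]_n) : 0 <= normF y.
Proof. exact: (amp_norm_ge0 i0 coordF_bounded). Qed.

Lemma normF_ge n i (y : 'M[F]_n) p (xi : 'M[C]_(n, p)) :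
  hn (crdF i y *m xi) <= normF y * hn xi.
Proof.
apply: opnorm_le_hn; split=> [|v]; first exact: normF_ge0.
rewrite !l2sqE -!hn_sqr -exprMn ler_pXn2r ?nnegrE ?mulr_ge0 ?normF_ge0 ?hn_ge0 //.
by rewrite -amp_coordF; exact: (amp_norm_ge coordF_bounded).
Qed.

Lemma normF_le n (y : 'M[F]_n) c : 0 <= c ->
  (forall i (xi : 'cV[C]_n), hn (crdF i y *m xi) <= c * hn xi) -> normF y <= c.
Proof.
move=> c0 h; apply: (amp_norm_le i0) => // i xi.
by rewrite amp_coordF.
Qed.

Lemma hn_const_mul (c : C) p (xi : 'M[C]_(1, p)) : hn ((const_mx c : 'M[C]_1) *m xi) = normc c * hn xi.
Proof.
rewrite (_ : const_mx c = c%:M) ?mul_scalar_mx ?hnZ //.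
by apply/matrixP => a b; rewrite !mxE !ord1.
Qed.

Lemma hn_one : hn (1%:M : 'M[C]_1) = 1.
Proof.
by rewrite /hn hsE !big_ord1 mxE eqxx ComplexField.Normc.normc1 expr1n sqrtr1.
Qed.

Lemma banachF : banach_operator_space normF.
Proof.
split.
  apply: (amp_operator_space i0 coordF_bounded) => v h; apply/rowP => i.
  by move/matrixP/(_ 0 0): (h i); rewrite !mxE eqxx.
have crd1 i (v : F) : crdF i (mx1 v) = const_mx (v 0 i).
  by apply/matrixP => a b; rewrite !mxE.
move=> u uc.
have [e /uc[N h]|f fP] := @uniform_cauchy_limit R 'I_k (fun n i => u n 0 i).
  exists N => a b Na Nb i; apply: le_trans (h _ _ Na Nb).
  have := normF_ge i (mx1 (u a - u b)) 1%:M.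
  by rewrite crd1 hn_const_mul hn_one !mulr1 !mxE.
exists (\row_i f i) => e e0; have [N h] := fP e e0; exists N => a Na.
apply: normF_le => [|i xi]; first exact: ltW.
by rewrite crd1 hn_const_mul !mxE ler_wpM2r ?hn_ge0 ?h.
Qed.

Definition dominates (s0 s : seq (mxtuple R k)) :=
  forall z, List.In z s0 -> List.In z s.

(** [None] is the point at infinity, carrying the limit as part of the data. Lists are directed by
    inclusion, with concatenations as upper bounds. *)
Definition convergent (x : option (seq (mxtuple R k)) -> F) : Prop :=
  (exists M, forall s i, normc (x s 0 i) <= M) /\
  forall e, 0 < e -> exists s0, forall s, dominates s0 s ->
    forall i, normc (x (Some s) 0 i - x None 0 i) <= e.

Definition convergent_pred : {pred (option (seq (mxtuple R k)) -> F)} :=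
  fun x => `[< convergent x >].

Lemma convergent_submod : submod_closed convergent_pred.
Proof.
split.
  apply/asboolP; split; first by exists 0 => s i; rewrite mxE ComplexField.Normc.normc0.
  by move=> e e0; exists [::] => s _ i; rewrite !mxE subrr ComplexField.Normc.normc0 ltW.
move=> c x y /asboolP[[Mx hx] cx] /asboolP[[My hy] cy]; apply/asboolP; split.
  exists (normc c * Mx + My) => s i; rewrite !mxE; apply: le_trans (normcD _ _) _.
  by rewrite ComplexField.Normc.normcM lerD // ler_wpM2l ?normc_ge0.
move=> e e0.
(* Adding 1 keeps the divisor positive when [c] is 0. *)
have c1 : 0 < normc c + 1 by rewrite ltr_wpDl ?normc_ge0.
have [|s1 h1] := cx (e / 2 / (normc c + 1)); first by rewrite !divr_gt0.
have [|s2 h2] := cy (e / 2); first by rewrite divr_gt0.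
exists (s1 ++ s2) => s ds i; rewrite !mxE.
have -> : c * x (Some s) 0 i + y (Some s) 0 i - (c * x None 0 i + y None 0 i)
   = c * (x (Some s) 0 i - x None 0 i) + (y (Some s) 0 i - y None 0 i) by ring.
apply: le_trans (normcD _ _) _; rewrite ComplexField.Normc.normcM.
have -> : e = e / 2 + e / 2 by field.
have d1 : dominates s1 s by move=> z hz; apply: ds; apply/List.in_app_iff; left.
have d2 : dominates s2 s by move=> z hz; apply: ds; apply/List.in_app_iff; right.
apply: lerD; last exact: h2.
apply: le_trans (_ : normc c * (e / 2 / (normc c + 1)) <= _).
  by rewrite ler_wpM2l ?normc_ge0 // h1.
rewrite mulrCA ler_piMr ?divr_ge0 ?ltW //.
by rewrite ltr_pdivrMr // mul1r ltrDl.
Qed.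

HB.instance Definition _ := GRing.isSubmodClosed.Build C _ convergent_pred convergent_submod.

Record convE := ConvE { conv_val :> option (seq (mxtuple R k)) -> F;
                        _ : conv_val \in convergent_pred }.

HB.instance Definition _ := [isSub for conv_val].
HB.instance Definition _ := [Choice of convE by <:].
HB.instance Definition _ := [SubChoice_isSubLmodule of convE by <:].

Lemma convE_P (x : convE) : convergent x.
Proof. by apply/asboolP; exact: (valP x). Qed.

Definition ev s i (x : convE) : C := x s 0 i.

Lemma ev_lin s i c x y : ev s i (c *: x + y) = c * ev s i x + ev s i y.
Proof. by rewrite /ev /= !mxE. Qed.

End Spaces.

(** * The space E and its quotient map onto F *)

Section Cover.
Variable R : realType.
Local Notation C := (R[i]).
Variable k : nat.
Hypothesis k0 : (0 < k)%N.
Local Notation F := ('rV[C]_k).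
Local Notation E := (convE R k).

(** At [None] every tuple is tested: the admissible maps there are complete contractions of
    l_infinity^k, so the norm at infinity is that of F. *)
Definition tested (s : option (seq (mxtuple R k))) (z : mxtuple R k) : Prop :=
  if s is Some s then List.In z s else True.

(** The tuple [a] stands for the map from F to the [d] by [d] matrices that sends the basis vector
    number [i] to [a i]. *)
Definition admissible s d (a : 'I_k -> 'M[C]_d) : Prop :=
  (forall i n (xi : 'M[C]_(n, d)), hn (xi *m a i) <= hn xi) /\
  forall z : mxtuple R k, tested s z -> contractive (projT2 z) ->
    forall xi, hn (\sum_i projT2 z i *m xi *m a i) <= hn xi.

Record idxE := IdxE { idx_s : option (seq (mxtuple R k)); idx_d : nat;
  idx_a : 'I_k -> 'M[C]_idx_d; idx_adm : admissible idx_s idx_a }.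

Definition thetaE (j : idxE) (x : E) : 'M[C]_(idx_d j) :=
  \sum_i ev (idx_s j) i x *: idx_a j i.

Lemma thetaE_linear j : linear (thetaE j).
Proof.
move=> c x y; rewrite /thetaE scaler_sumr -big_split; apply: eq_bigr => i _ /=.
by rewrite ev_lin scalerDl scalerA.
Qed.

HB.instance Definition _ j :=
  GRing.isLinear.Build C E 'M[C]_(idx_d j) _ (thetaE j) (thetaE_linear j).

Local Notation thE := (fun j => thetaE j : {linear E -> 'M[C]_(idx_d j)}).

Definition normE : forall n, 'M[E]_n -> R := @amp_norm R E idxE idx_d thE.

Definition crdE n s i (x : 'M[E]_n) : 'M[C]_n := map_mx (ev s i) x.

Lemma amp_thetaE j n (x : 'M[E]_n) (xi : 'M[C]_(n, idx_d j)) :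
  @amp R E idxE idx_d thE j _ _ x xi
  = \sum_i crdE (idx_s j) i x *m xi *m idx_a j i.
Proof.
apply/row_matrixP => a; rewrite row_amp linear_sum /=.
under [RHS]eq_bigr => i _.
  rewrite !row_mul (mulmx_sum_row (row a _)) mulmx_suml.
  over.
rewrite exchange_big; apply: eq_bigr => l _; rewrite /thetaE mulmx_sumr.
by apply: eq_bigr => i _; rewrite !mxE -scalemxAr -scalemxAl.
Qed.

Lemma sum_pick n d (X : 'I_k -> 'M[C]_(n, d)) (i : 'I_k) :
  \sum_j X j *m ((j == i)%:R%:M : 'M[C]_d) = X i.
Proof.
rewrite (bigD1 i) //= eqxx mulmx1 big1 ?addr0 // => j /negbTE ->.
by rewrite mul_mx_scalar scale0r.
Qed.

(** Coordinate functionals are allowed at every index, so [normE] dominates all coordinates;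
    completeness and the contractivity of [coverq] rest on this. *)
Lemma coord_admissible s i : admissible s (fun j => (j == i)%:R%:M : 'M[C]_1).
Proof.
split=> [j n xi|z _ zc xi]; last first.
  rewrite sum_pick -[leRHS]mul1r; apply: hn_le => //; rewrite expr1n mul1r; exact: zc.
rewrite hn_scalar; case: (j == i).
  by rewrite ComplexField.Normc.normc1 mul1r.
by rewrite ComplexField.Normc.normc0 mul0r hn_ge0.
Qed.

Definition coord_idx s i : idxE := IdxE (coord_admissible s i).

Lemma amp_coord_idx s i n (x : 'M[E]_n) (xi : 'cV[C]_n) :
  @amp R E idxE idx_d thE (coord_idx s i) _ _ x xi = crdE s i x *m xi.
Proof. by rewrite amp_thetaE /= sum_pick. Qed.

Lemma thetaE_bounded (x : E) : exists2 M : R, 0 <= M &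
  forall j (w : 'rV[C]_(idx_d j)), hn (w *m thetaE j x) <= M * hn w.
Proof.
have [[M hM] _] := convE_P x.
have M0 : 0 <= M by apply: le_trans (hM None (Ordinal k0)); exact: normc_ge0.
exists (k%:R * M); first by rewrite mulr_ge0 ?ler0n.
move=> j w; rewrite /thetaE mulmx_sumr; apply: le_trans (hn_sum _ _ _) _.
have -> : k%:R * M * hn w = \sum_(i < k) M * hn w.
  by rewrite sumr_const card_ord -mulrA mulr_natl.
apply: ler_sum => i _; rewrite -scalemxAr hnZ; apply: ler_pM; rewrite ?normc_ge0 ?hn_ge0 //.
  exact: hM.
exact: (idx_adm j).1.
Qed.

Let j0 : idxE := coord_idx None (Ordinal k0).

Lemma normE_ge0 n (x : 'M[E]_n) : 0 <= normE x.
Proof. exact: (amp_norm_ge0 j0 thetaE_bounded). Qed.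

Lemma normE_coord_le s i n (x : 'M[E]_n) p (xi : 'M[C]_(n, p)) :
  hn (crdE s i x *m xi) <= normE x * hn xi.
Proof.
apply: opnorm_le_hn; split=> [|v]; first exact: normE_ge0.
rewrite !l2sqE -!hn_sqr -exprMn ler_pXn2r ?nnegrE ?mulr_ge0 ?normE_ge0 ?hn_ge0 //.
by rewrite -amp_coord_idx; exact: (@amp_norm_ge _ _ _ _ thE thetaE_bounded _ x (coord_idx s i) v).
Qed.

Lemma normE_ge n (x : 'M[E]_n) s d (a : 'I_k -> 'M[C]_d) (xi : 'M[C]_(n, d)) :
  admissible s a -> hn (\sum_i crdE s i x *m xi *m a i) <= normE x * hn xi.
Proof.
move=> adm; have := @amp_norm_ge _ _ _ _ thE thetaE_bounded _ x (IdxE adm) xi.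
by rewrite amp_thetaE.
Qed.

Lemma normE_le n (x : 'M[E]_n) c : 0 <= c ->
  (forall s d (a : 'I_k -> 'M[C]_d) (xi : 'M[C]_(n, d)), admissible s a ->
     hn (\sum_i crdE s i x *m xi *m a i) <= c * hn xi) -> normE x <= c.
Proof.
move=> c0 h; apply: (amp_norm_le j0) => // j xi.
by rewrite amp_thetaE; apply: h; exact: idx_adm.
Qed.

Lemma convE_ext (x y : E) : (forall s i, ev s i x = ev s i y) -> x = y.
Proof.
by move=> h; apply: val_inj; apply/funext => s; apply/rowP => i; exact: h.
Qed.

Lemma convergent_limit (u : nat -> E) (f : option (seq (mxtuple R k)) -> F) :
  (forall e, 0 < e -> exists N, forall n, (N <= n)%N ->
     forall s i, normc (u n s 0 i - f s 0 i) <= e) -> convergent f.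
Proof.
move=> uf; split.
  have [N /(_ N (leqnn _)) h] := uf 1 ltr01; have [[M hM] _] := convE_P (u N).
  exists (M + 1) => s i.
  have -> : f s 0 i = u N s 0 i - (u N s 0 i - f s 0 i) by ring.
  by apply: le_trans (normcD _ _) _; rewrite normcN lerD.
move=> e e0; have e3 : 0 < e / 3 by rewrite divr_gt0.
have [N /(_ N (leqnn _)) h] := uf _ e3; have [_ cv] := convE_P (u N).
have [s0 hs0] := cv _ e3; exists s0 => s ds i.
have -> : f (Some s) 0 i - f None 0 i = - (u N (Some s) 0 i - f (Some s) 0 i)
   + ((u N (Some s) 0 i - u N None 0 i) + (u N None 0 i - f None 0 i)) by ring.
have -> : e = e / 3 + (e / 3 + e / 3) by field.
apply: le_trans (normcD _ _) _; rewrite normcN; apply: lerD => //.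
by apply: le_trans (normcD _ _) _; apply: lerD => //; exact: hs0.
Qed.

Lemma banachE : banach_operator_space normE.
Proof.
split.
  apply: (amp_operator_space j0 thetaE_bounded) => x h; apply: convE_ext => s i.
  have := h (coord_idx s i); rewrite /= /thetaE => /matrixP/(_ 0 0).
  rewrite summxE (bigD1 i) //= big1 ?addr0 => [|j /negbTE ji]; last by rewrite ji !mxE mul0rn mulr0.
  by rewrite eqxx !mxE eqxx mulr1 => ->; rewrite /ev /= mxE.
have crd1 s i (v : E) : crdE s i (mx1 v) = const_mx (ev s i v).
  by apply/matrixP => a b; rewrite !mxE.
have evB s i (x y : E) : ev s i (x - y) = x s 0 i - y s 0 i by rewrite /ev /= !mxE.
move=> u uc.
have [e /uc[N h]|f fP] := @uniform_cauchy_limit R (option (seq (mxtuple R k)) * 'I_k)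
    (fun n si => u n si.1 0 si.2).
  exists N => a b Na Nb si; apply: le_trans (h _ _ Na Nb).
  have := normE_coord_le si.1 si.2 (mx1 (u a - u b)) 1%:M.
  by rewrite crd1 hn_const_mul hn_one !mulr1 evB.
pose g s : F := \row_i f (s, i).
have gP e : 0 < e -> exists N, forall n, (N <= n)%N ->
     forall s i, normc (u n s 0 i - g s 0 i) <= e.
  move=> /fP[N h]; exists N => n Nn s i; rewrite mxE; exact: (h n Nn (s, i)).
have gc : g \in @convergent_pred R k by apply/asboolP; exact: convergent_limit gP.
exists (ConvE gc) => e e0.
have kR : 0 < k%:R :> R by rewrite ltr0n.
(* An admissible tuple consists of [k] contractions, so errors of [e / k] in the coordinates add up
   to [e]. *)
have [|N h] := gP (e / k%:R); first by rewrite divr_gt0.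
exists N => n Nn; apply: normE_le => [|s d a xi adm]; first exact: ltW.
apply: le_trans (hn_sum _ _ _) _.
have -> : e * hn xi = \sum_(i < k) e / k%:R * hn xi.
  by rewrite sumr_const card_ord -[RHS]mulr_natl mulrA mulrCA mulfV ?mulr1 // gt_eqF.
apply: ler_sum => i _; rewrite crd1 -mulmxA hn_const_mul evB; apply: ler_pM;
  rewrite ?normc_ge0 ?hn_ge0 //; [exact: h | exact: adm.1].
Qed.

Definition coverq (x : E) : F := x None.

Lemma coverq_linear : linear coverq.
Proof. by []. Qed.

HB.instance Definition _ := GRing.isLinear.Build C E F _ coverq coverq_linear.

Lemma crd_coverq n i (x : 'M[E]_n) : crdF i (map_mx coverq x) = crdE None i x.
Proof. by apply/matrixP => a b; rewrite !mxE. Qed.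

Section Lift.
Variables (z : mxtuple R k) (v : F).

(** The family vanishes where [z] is not tested, since nothing controls the norm of [v] there; it
    still converges, every list containing [z] giving [v]. *)
Definition lift_fun (s : option (seq (mxtuple R k))) : F :=
  if `[< tested s z >] then v else 0.

Lemma lift_convergent : lift_fun \in @convergent_pred R k.
Proof.
apply/asboolP; split.
  exists (\sum_i normc (v 0 i)) => s i; rewrite /lift_fun; case: ifP => _.
    by rewrite (bigD1 i) //= lerDl sumr_ge0 // => j _; exact: normc_ge0.
  by rewrite mxE ComplexField.Normc.normc0; apply: sumr_ge0 => j _; exact: normc_ge0.
move=> e e0; exists [:: z] => s ds i; rewrite /lift_fun.
have -> : `[< tested (Some s) z >] by apply/asboolP; apply: ds; left.
have -> : `[< tested None z >] by apply/asboolP.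
by rewrite subrr ComplexField.Normc.normc0 ltW.
Qed.

Definition lift_conv : E := ConvE lift_convergent.

Lemma ev_lift s i : ev s i lift_conv = if `[< tested s z >] then v 0 i else 0.
Proof. by rewrite /ev /= /lift_fun; case: ifP => // _; rewrite mxE. Qed.

End Lift.

Lemma coverq_lift z v : coverq (lift_conv z v) = v.
Proof.
rewrite /coverq /= /lift_fun.
by have -> : `[< tested None z >] by apply/asboolP.
Qed.

Lemma coverq_complete_quotient :
  complete_quotient normE (@normF R k) (coverq : {linear E -> F}).
Proof.
split=> [y|n y].
  by exists (lift_conv (existT _ 0%N (fun=> 0)) y); exact: coverq_lift.
split=> [x <-|e e0].
  apply: normF_le => // [|i xi]; first exact: normE_ge0.
  by rewrite crd_coverq normE_coord_le.
(* Half of [e] makes [c] positive yet smaller than [normF y + e]. Divided by [c], the coordinates of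
   [y] form a contractive tuple [z], so admissible maps at an index testing [z] are bounded by [c]
   on [y]. *)
pose c := normF y + e / 2.
have c0 : 0 < c by rewrite ltr_wpDl ?normF_ge0 ?divr_gt0.
have nc : normc ((c^-1)%:C)%C = c^-1 by rewrite normc_real ger0_norm // invr_ge0 ltW.
pose z : mxtuple R k := existT _ n (fun i => ((c^-1)%:C)%C *: crdF i y).
have zc : contractive (projT2 z).
  move=> i v /=; rewrite -!hn_sqr ler_pXn2r ?nnegrE ?hn_ge0 //.
  rewrite -scalemxAl hnZ nc ler_pdivrMl //.
  apply: le_trans (normF_ge k0 i y v) _; rewrite ler_wpM2r ?hn_ge0 //.
  by rewrite lerDl divr_ge0 ?ltW.
exists (map_mx (lift_conv z) y); split.
  by apply/matrixP => a b; rewrite !mxE; exact: coverq_lift.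
apply: le_lt_trans (_ : c < _); last first.
  by rewrite ltrD2l ltr_pdivrMr // ltr_pMr // ltr1n.
apply: normE_le => [|s d a xi adm]; first exact: ltW.
have [tz|ntz] := pselect (tested s z); last first.
  rewrite big1 ?hn0 ?mulr_ge0 ?hn_ge0 ?ltW // => i _.
  rewrite (_ : crdE _ _ _ = 0) ?mul0mx //; apply/matrixP => b l.
  by rewrite !mxE ev_lift asboolF.
have crd_lift i : crdE s i (map_mx (lift_conv z) y) = crdF i y.
  by apply/matrixP => b l; rewrite !mxE ev_lift asboolT.
under eq_bigr do rewrite crd_lift.
have h : hn (((c^-1)%:C)%C *: \sum_i crdF i y *m xi *m a i) <= hn xi.
  apply: le_trans (adm.2 z tz zc xi); rewrite scaler_sumr le_eqVlt; apply/orP; left.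
  by apply/eqP; congr hn; apply: eq_bigr => i _; rewrite -!scalemxAl.
by move: h; rewrite hnZ nc ler_pdivrMl.
Qed.

End Cover.

(** * Uniform convergence on finite-dimensional subspaces *)

Section FiniteDimensional.
Variable R : realType.
Local Notation C := (R[i]).

(** Otherwise vectors could be added one by one, each raising the rank, until it exceeds [d]. *)
Lemma spanning_rows (I : Type) d (f : I -> 'rV[C]_d) :
  exists p (g : 'I_p -> I), forall z, (f z <= \matrix_(l < p) f (g l))%MS.
Proof.
apply: contrapT => nex.
suff /(_ d.+1) [p [g]] : forall r, exists p (g : 'I_p -> I),
    (r <= \rank (\matrix_(l < p) f (g l)))%N.
  by rewrite leqNgt ltnS rank_leq_col.
elim=> [|r [p [g rg]]]; first by exists 0%N, (fun i : 'I_0 => match notF (ltn_ord i) with end).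
have [z nz] : exists z, ~ (f z <= \matrix_(l < p) f (g l))%MS.
  by apply: contrapT => h; apply: nex; exists p, g => z; apply: contrapT => hz; apply: h; exists z.
pose g' (i : 'I_(p + 1)) := if fintype.split i is inl l then g l else z.
exists (p + 1)%N, g'.
have -> : \matrix_(l < p + 1) f (g' l) = col_mx (\matrix_(l < p) f (g l)) (f z).
  apply/row_matrixP => i; rewrite rowK /g'; case: (split_ordP i) => a ->.
    by rewrite rowKu rowK.
  by rewrite rowKd; apply/rowP => j; rewrite !mxE ord1.
apply: leq_ltn_trans rg _; apply: rank_ltmx; rewrite ltmxE.
apply/andP; split; first by rewrite -addsmxE addsmxSl.
by apply: contra_notN nz; rewrite -addsmxE addsmx_sub => /andP[].
Qed.

Variable k : nat.
Hypothesis k0 : (0 < k)%N.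
Local Notation E := (convE R k).

Lemma ev_sum s i d (c : 'I_d -> C) (t : 'I_d -> E) :
  ev s i (\sum_j c j *: t j) = \sum_j c j * ev s i (t j).
Proof.
apply: (big_rec2 (fun x y => ev s i x = y)) => [|j x y _ <-]; last exact: ev_lin.
by rewrite /ev /= mxE.
Qed.

Lemma seq_convergent (t : seq E) e : 0 < e -> exists s0, forall s, dominates s0 s ->
  forall (j : 'I_(size t)) i, normc (ev (Some s) i t`_j - ev None i t`_j) <= e.
Proof.
move=> e0; elim: t => [|x t [s1 h1]]; first by exists [::] => s _ [].
have [_ /(_ e e0)[s2 h2]] := convE_P x; exists (s1 ++ s2) => s ds [[|j] jt] i /=.
  by apply: h2 => z hz; apply: ds; apply/List.in_app_iff; right.
apply: (h1 s _ (Ordinal (jt : (j < size t)%N)) i) => z hz.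
by apply: ds; apply/List.in_app_iff; left.
Qed.

(* On a finite dimensional space finitely many of the functionals [ev s i] span
   all of them, so the pointwise convergence defining [E] is uniform there, at
   all matrix levels at once. *)
Lemma fspan_uniform (t : seq E) delta : 0 < delta ->
  exists s : seq (mxtuple R k), forall n (x : 'M[E]_n),
    (forall a l, fspan t (x a l)) -> forall i p (xi : 'M[C]_(n, p)),
    hn ((crdE (Some s) i x - crdE None i x) *m xi) <= delta * normE x * hn xi.
Proof.
move=> d0; pose d := size t.
pose f (z : option (seq (mxtuple R k)) * 'I_k) : 'rV[C]_d := \row_j ev z.1 z.2 t`_j.
have [p [g gP]] := spanning_rows f.
set V := \matrix_(l < p) f (g l) in gP; pose W := pinvmx V.
(* The coefficients of a row in terms of the rows of [V] add up to at most [K] times its largest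
   entry. *)
pose K := \sum_(l < p) \sum_(j < d) normc (W j l).
have K0 : 0 <= K.
  by apply: sumr_ge0 => l _; apply: sumr_ge0 => j _; exact: normc_ge0.
have K1 : 0 < K + 1 by rewrite ltr_wpDl.
have [|s0 hs] := @seq_convergent t (delta / (K + 1)); first by rewrite divr_gt0.
exists s0 => n x xt i q xi.
have {}hs := hs s0 (fun z h => h).
(* [tau] is the difference of the two evaluations on the list [t], small in each entry; [kap] writes
   it through the evaluations [g l], each bounded by [normE] at all matrix levels. *)
pose tau := f (Some s0, i) - f (None, i).
pose kap := tau *m W.
have tauE : tau = kap *m V.
  by rewrite /kap mulmxKpV // addmx_sub ?eqmx_opp.
have -> : crdE (Some s0) i x - crdE None i x
    = \sum_l kap 0 l *: crdE (g l).1 (g l).2 x.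
  apply/matrixP => a b; rewrite !mxE summxE; have [c cE] := xt a b.
  rewrite cE !ev_sum -sumrB.
  transitivity (\sum_(j < d) c j * tau 0 j).
    by apply: eq_bigr => j _; rewrite !mxE mulrBr.
  rewrite tauE; under eq_bigr do rewrite mxE mulr_sumr.
  rewrite exchange_big; apply: eq_bigr => l _.
  rewrite !mxE cE ev_sum mulr_sumr; apply: eq_bigr => j _.
  by rewrite !mxE mulrCA.
rewrite mulmx_suml; apply: le_trans (hn_sum _ _ _) _.
apply: le_trans (_ : \sum_l normc (kap 0 l) * (normE x * hn xi) <= _).
  apply: ler_sum => l _; rewrite -scalemxAl hnZ ler_wpM2l ?normc_ge0 //.
  exact: normE_coord_le.
rewrite -mulr_suml -mulrA ler_wpM2r ?mulr_ge0 ?hn_ge0 ?normE_ge0 //.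
apply: le_trans (_ : \sum_(l < p) delta / (K + 1) * \sum_(j < d) normc (W j l) <= _).
  apply: ler_sum => l _; rewrite /kap mxE; apply: le_trans (normc_sum _) _.
  rewrite mulr_sumr; apply: ler_sum => j _; rewrite ComplexField.Normc.normcM.
  by rewrite ler_wpM2r ?normc_ge0 // !mxE; exact: hs.
rewrite -mulr_sumr -/K -mulrA ler_piMr ?ltW //.
by rewrite ltr_pdivrMl // mulr1 ltrDl.
Qed.

Lemma fspan_full : exists s : seq 'rV[C]_k, forall v, fspan s v.
Proof.
pose s := mkseq (fun n => \row_(j < k) (j == n :> nat)%:R : 'rV[C]_k) k.
have ss : size s = k by rewrite size_mkseq.
exists s => v; pose c n : C := if insub n is Some j then v 0 j else 0.
exists (fun i => c i).
transitivity (\sum_(0 <= n < size s) c n *: s`_n); last by rewrite big_mkord.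
rewrite ss big_mkord; apply/rowP => j; rewrite summxE (bigD1 j) //= big1 ?addr0.
  by rewrite /c valK mxE nth_mkseq // mxE eqxx mulr1.
move=> i ij; rewrite mxE nth_mkseq // mxE.
by rewrite (_ : (j == i :> nat) = false) ?mulr0 //; apply: contraNF ij => /eqP/val_inj ->.
Qed.

End FiniteDimensional.

(** * Refutation of finite-dimensional lifting *)

Theorem theorem2p10 (R : realType) :
  ~ (forall (E F : lmodType R[i])
        (nE : forall n, 'M[E]_n -> R) (nF : forall n, 'M[F]_n -> R),
        banach_operator_space nE -> banach_operator_space nF ->
        forall q : {linear E -> F}, complete_quotient nE nF q ->
        forall (s : seq F) (eps : R), 0 < eps ->
        exists t : seq E,
          (forall y : F, fspan s y <-> exists x : E, fspan t x /\ q x = y) /\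
          forall (n : nat) (y : 'M[F]_n), (forall i j, fspan s (y i j)) ->
            exists x : 'M[E]_n, (forall i j, fspan t (x i j)) /\
              map_mx q x = y /\ nE n x <= (1 + eps) * nF n y).
Proof.
move=> H.
(* For [k] = 2048 one has 8 * 2048 = 128^2 and 8 * 128 = 1024 < 2048, as [separating_tuple]
   requires. *)
pose beta : R := 128%:R.
have [k [k0 kE kb]] : exists k, [/\ (0 < k)%N, (8 * k)%:R = beta ^+ 2 & 8 * beta < k%:R].
  exists (16 * 128)%N; split=> //; rewrite /beta.
    by rewrite -natrX; congr _%:R; rewrite mulnA expnS expn1.
  by rewrite -natrM ltr_nat ltn_mul2r.
(* The subspace to be lifted is all of F, with epsilon equal to 1. *)
have [s sfull] := fspan_full R k.
have [t [_ lift]] := H _ _ _ _ (banachE R k0) (banachF R k0) _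
  (coverq_complete_quotient R k0) s 1 ltr01.
have kR : 0 < k%:R :> R by rewrite ltr0n.
(* The list [s0] depends on [t] only, and the matrices [u] are chosen afterwards against [s0]. The
   accuracy is the inverse of [k] because [k] coordinates contribute errors. *)
have [|s0 sP] := fspan_uniform k0 t (delta := k%:R^-1); first by rewrite invr_gt0.
have b1 : 1 <= beta by rewrite /beta ler1n.
have [m [a [ac az [u [xi [uc uxi]]]]]] := separating_tuple s0 b1 kE kb.
pose y : 'M['rV[R[i]]_k]_m := \matrix_(b, l) \row_i u i b l.
have crdy i : crdF i y = u i by apply/matrixP => b l; rewrite !mxE.
have [x [xt [qx nx]]] := lift m y (fun i j => sfull _).
have ny : normF y <= 1.
  apply: normF_le => // i v; rewrite crdy mul1r -[leRHS]mul1r; apply: hn_le => //.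
  by rewrite expr1n mul1r; exact: uc.
have nx2 : normE x <= 2 by apply: le_trans nx _; lra.
have adm : admissible (Some s0) a by split.
have := normE_ge k0 x xi adm.
have crdN i : crdE None i x = u i by rewrite -crd_coverq -crdy -qx.
set X := \sum_i _ => hX.
have diff : hn (\sum_i (u i - crdE (Some s0) i x) *m xi *m a i) <= normE x * hn xi.
  apply: le_trans (hn_sum _ _ _) _.
  have -> : normE x * hn xi = \sum_(i < k) k%:R^-1 * normE x * hn xi.
    by rewrite sumr_const card_ord -[RHS]mulr_natl !mulrA mulfV ?mul1r // gt_eqF.
  apply: ler_sum => i _; apply: le_trans (ac _ _ _) _.
  by rewrite -opprB mulNmx -scaleN1r hnZ normcN ComplexField.Normc.normc1 mul1r -crdN sP.
(* The value at the index [s0] and the deviation from the limit contribute at most [2 * hn xi] each,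
   which contradicts the lower bound [4 * hn xi]. *)
move: uxi; apply/negP; rewrite -leNgt.
have -> : \sum_i u i *m xi *m a i
    = X + \sum_i (u i - crdE (Some s0) i x) *m xi *m a i.
  by rewrite /X -big_split /=; apply: eq_bigr => i _; rewrite -!mulmxDl addrC subrK.
apply: le_trans (hnD _ _) _; apply: le_trans (lerD hX diff) _.
rewrite -mulrDl ler_wpM2r ?hn_ge0 //.
have -> : 4 = 2 + 2 :> R by rewrite -natrD.
exact: lerD.
Qed.
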